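(* Let $\hat\sigma^{st}$ be a spatio-temporal triangle database schema and $\overline\sigma^{st}$ the corresponding semi-algebraic schema. The language $\mathrm{FO}(\{\mathbf{PartOf}^{\mathrm{Cotemp}},\mathbf{Before}_\vartriangle,\mathbf{SAS}\})(\hat\sigma^{st})$ is sound and complete for the $(\mathcal{AC}_{st},\mathcal A_t)$-generic $\mathrm{FO}(+,\times,<,0,1)(\overline\sigma^{st})$-queries on triangle databases over $\hat\sigma^{st}$: every query expressed in the language is $(\mathcal{AC}_{st},\mathcal A_t)$-generic and $\mathrm{FO}(+,\times,<,0,1)(\overline\sigma^{st})$-expressible, and every such generic expressible query is expressed in the language.
   Context: A spatio-temporal point is $(x,\tau)\in\mathbb{R}^2\times\mathbb{R}$. A spatio-temporal triangle is a triple of co-temporal spatio-temporal points (common time = time of the triangle); its drawing is the convex hull of its corners; its center of mass is the average of its corners. A set is semi-algebraic if it is a Boolean combination of sets $\{p>0\}$, $p$ an integer polynomial. A spatio-temporal triangle relation of arity $k$ is a set of $k$-tuples of spatio-temporal triangles whose coordinate image in $\mathbb{R}^{9k}$ is semi-algebraic and which is closed under independently permuting corners of each triangle. A schema $\hat\sigma^{st}$ is a finite set of relation names with arities; a database assigns relations of matching arity; a $k$-ary query is a computable partial map from databases to $k$-ary relations. $\overline\sigma^{st}$ has a name of arity $9\cdot ar(\hat R)$ per $\hat R$; a query is $\mathrm{FO}(+,\times,<,0,1)(\overline\sigma^{st})$-expressible if a first-order formula over the reals (integer polynomial inequalities, these relation names) with $9k$ free variables defines the coordinate image of its output on every database. $(\mathcal{AC}_{st},\mathcal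 A_t)$ is the group of maps $(x,t)\mapsto(Mx+b+ct,g(t))$ with $M$ a fixed invertible $2\times2$ matrix, $b,c\in\mathbb{R}^2$, and $g$ an affinity of $\mathbb{R}$. A query $Q$ is $G$-generic if $Q(\gamma(\mathcal D))=\gamma(Q(\mathcal D))$ for all $\gamma\in G$ and databases $\mathcal D$ ($\gamma$ acting cornerwise). The language has variables ranging over spatio-temporal triangles, atoms: equality (equal drawings), relation names, $\mathbf{PartOf}^{\mathrm{Cotemp}}(t_1,t_2)$ (drawing of $t_1\subseteq$ drawing of $t_2$), $\mathbf{Before}_\vartriangle(t_1,t_2)$ (time of $t_1\le$ time of $t_2$), and $\mathbf{SAS}(t_1,t_2,t_3,t_4)$: with centers of mass $(a_i,b_i,\tau_i)$ of $t_i$, it holds iff $\tau_1\le\tau_2$, $\tau_3\le\tau_4$, $\frac{a_2-a_1}{\tau_2-\tau_1}=\frac{a_4-a_3}{\tau_4-\tau_3}$ and $\frac{b_2-b_1}{\tau_2-\tau_1}=\frac{b_4-b_3}{\tau_4-\tau_3}$.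
   Formalization: Affinities of time are taken order-preserving (with time reversal allowed, the query Before is expressed but not generic), and Q(γ(D)) = γ(Q(D)) is required only when γ(D) is itself a database over integer polynomials, since otherwise Q(γ(D)) is undefined. *)

(* Defs.v *)
From mathcomp Require Import all_boot all_order all_fingroup all_algebra.
From mathcomp Require Import boolp classical_sets reals.

Set Implicit Arguments.
Unset Strict Implicit.
Unset Printing Implicit Defensive.

Import Order.TTheory GRing.Theory Num.Theory.

Local Open Scope classical_set_scope.
Local Open Scope ring_scope.

Definition stpoint (R : realType) : Type := ('cV[R]_2 * R)%type.

(* Degenerate triangles (coinciding or collinear corners) are allowed. *)
Record triangle (R : realType) := Triangle {
  corners : 3.-tuple (stpoint R);
  corners_cotemporal :
    [forall i, forall j, (tnth corners i).2 == (tnth corners j).2] }.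

Section Triangles.
Variable R : realType.
Implicit Types (p : stpoint R) (t : triangle R).

Definition tri_time t : R := (tnth (corners t) ord0).2.

(* The convex hull of the corners, as a subset of R^2 x R. *)
Definition drawing t : set (stpoint R) :=
  [set p | exists w : 'I_3 -> R,
     [/\ forall i, 0 <= w i,
         \sum_i w i = 1,
         p.1 = \sum_i w i *: (tnth (corners t) i).1
       & p.2 = \sum_i w i * (tnth (corners t) i).2]].

Definition center_of_mass t : stpoint R :=
  (3^-1 *: \sum_i (tnth (corners t) i).1, 3^-1 * \sum_i (tnth (corners t) i).2).

Lemma perm_cotemporal t (s : 'S_3) :
  let c := [tuple tnth (corners t) (s i) | i < 3] in
  [forall i, forall j, (tnth c i).2 == (tnth c j).2].
Proof.
apply/forallP => i; apply/forallP => j; rewrite !tnth_mktuple.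
exact: (forallP (forallP (corners_cotemporal t) (s i))).
Qed.

Definition permute_corners t (s : 'S_3) : triangle R :=
  Triangle (perm_cotemporal t s).

(* The coordinates of a tuple of triangles: triangles in order, for each of
   them its corners in order, and for each corner its two spatial coordinates
   followed by its time. *)
Definition point_coords p : 3.-tuple R :=
  [tuple p.1 ord0 ord0; p.1 ord_max ord0; p.2].

Definition coords_seq k (T : k.-tuple (triangle R)) : seq R :=
  flatten [seq flatten [seq tval (point_coords p) | p <- corners t] | t <- T].

Lemma size_coords_seq k (T : k.-tuple (triangle R)) :
  size (coords_seq T) == (9 * k)%N.
Proof.
rewrite -[in X in _ == X](size_tuple T) /coords_seq.
elim: (tval T) => [|t s IHs] //=; rewrite size_cat (eqP IHs) mulnS eqn_add2r.
by case: (corners t) => [[|a [|b [|c []]]]].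
Qed.

Definition coords k (T : k.-tuple (triangle R)) : (9 * k).-tuple R :=
  Tuple (size_coords_seq T).

Definition PartOf_cotemp t1 t2 : Prop := drawing t1 `<=` drawing t2.

Definition Before t1 t2 : Prop := tri_time t1 <= tri_time t2.

(* An equality of fractions is taken to hold only when both fractions are
   defined, hence the two disequalities: [x / 0] is 0 in the library. *)
Definition SAS t1 t2 t3 t4 : Prop :=
  let: (x1, tau1) := center_of_mass t1 in
  let: (x2, tau2) := center_of_mass t2 in
  let: (x3, tau3) := center_of_mass t3 in
  let: (x4, tau4) := center_of_mass t4 in
  [/\ tau1 <= tau2 /\ tau3 <= tau4, tau2 - tau1 != 0, tau4 - tau3 != 0
    & forall i : 'I_2, (x2 i ord0 - x1 i ord0) / (tau2 - tau1) =
                       (x4 i ord0 - x3 i ord0) / (tau4 - tau3)].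

End Triangles.

(* Integer polynomials in n variables, as expressions. *)
Inductive zpoly (n : nat) : Type :=
| ZVar of 'I_n
| ZZero
| ZOne
| ZOpp of zpoly n
| ZAdd of zpoly n & zpoly n
| ZMul of zpoly n & zpoly n.

Arguments ZZero {n}.
Arguments ZOne {n}.

Fixpoint zpoly_eval (R : realType) n (p : zpoly n) (v : n.-tuple R) : R :=
  match p with
  | ZVar i => tnth v i
  | ZZero => 0
  | ZOne => 1
  | ZOpp p1 => - zpoly_eval p1 v
  | ZAdd p1 p2 => zpoly_eval p1 v + zpoly_eval p2 v
  | ZMul p1 p2 => zpoly_eval p1 v * zpoly_eval p2 v
  end.

(* Boolean combinations of sets {p > 0}. *)
Inductive sa_desc (n : nat) : Type :=
| SPos of zpoly n
| SNot of sa_desc n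
| SAnd of sa_desc n & sa_desc n
| SOr of sa_desc n & sa_desc n.

Fixpoint sa_set (R : realType) n (f : sa_desc n) : set (n.-tuple R) :=
  match f with
  | SPos p => [set v | 0 < zpoly_eval p v]
  | SNot f1 => ~` sa_set f1
  | SAnd f1 f2 => sa_set f1 `&` sa_set f2
  | SOr f1 f2 => sa_set f1 `|` sa_set f2
  end.

Definition semialgebraic (R : realType) n (A : set (n.-tuple R)) : Prop :=
  exists f : sa_desc n, A = sa_set f.

Record strelation (R : realType) (k : nat) := STRelation {
  strel_set :> set (k.-tuple (triangle R));
  strel_semialgebraic : semialgebraic (@coords R k @` strel_set);
  strel_perm : forall (T : k.-tuple (triangle R)) (s : 'I_k -> 'S_3),
    strel_set T ->
    strel_set [tuple permute_corners (tnth T i) (s i) | i < k] }.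

Record schema := Schema { relname : finType; arity : relname -> nat }.

Definition database (R : realType) (sigma : schema) : Type :=
  forall r : relname sigma, strelation R (arity r).

(* Partial recursive functions, with lists of natural numbers as arguments. *)
Inductive recfun : Type :=
| RZero
| RSucc
| RProj of nat
| RComp of recfun & seq recfun
| RPrim of recfun & recfun
| RMin of recfun.

Inductive rec_eval : recfun -> seq nat -> nat -> Prop :=
| eval_zero s : rec_eval RZero s 0%N
| eval_succ x s : rec_eval RSucc (x :: s) x.+1
| eval_proj i s : (i < size s)%N -> rec_eval (RProj i) s (nth 0%N s i)
| eval_comp f gs s ys y :
    rec_evals gs s ys -> rec_eval f ys y -> rec_eval (RComp f gs) s y
| eval_prim0 f g s y :
    rec_eval f s y -> rec_eval (RPrim f g) (0%N :: s) y
| eval_primS f g m s z y :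
    rec_eval (RPrim f g) (m :: s) z -> rec_eval g (m :: z :: s) y ->
    rec_eval (RPrim f g) (m.+1 :: s) y
| eval_min f s m :
    rec_eval f (m :: s) 0%N ->
    (forall i, (i < m)%N -> exists y, rec_eval f (i :: s) y.+1) ->
    rec_eval (RMin f) s m
with rec_evals : seq recfun -> seq nat -> seq nat -> Prop :=
| evals_nil s : rec_evals [::] s [::]
| evals_cons g gs s y ys :
    rec_eval g s y -> rec_evals gs s ys -> rec_evals (g :: gs) s (y :: ys).

(* Goedel numbers of semi-algebraic descriptions; [CodeSeq.code] is a
   computable bijection from [seq nat] to [nat]. *)
Fixpoint zpoly_code n (p : zpoly n) : nat :=
  match p with
  | ZVar i => CodeSeq.code [:: 0; val i]
  | ZZero => CodeSeq.code [:: 1]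
  | ZOne => CodeSeq.code [:: 2]
  | ZOpp p1 => CodeSeq.code [:: 3; zpoly_code p1]
  | ZAdd p1 p2 => CodeSeq.code [:: 4; zpoly_code p1; zpoly_code p2]
  | ZMul p1 p2 => CodeSeq.code [:: 5; zpoly_code p1; zpoly_code p2]
  end%N.

Fixpoint sa_code n (f : sa_desc n) : nat :=
  match f with
  | SPos p => CodeSeq.code [:: 0; zpoly_code p]
  | SNot f1 => CodeSeq.code [:: 1; sa_code f1]
  | SAnd f1 f2 => CodeSeq.code [:: 2; sa_code f1; sa_code f2]
  | SOr f1 f2 => CodeSeq.code [:: 3; sa_code f1; sa_code f2]
  end%N.

Definition describes (R : realType) k (f : sa_desc (9 * k))
  (S : strelation R k) : Prop := @coords R k @` S = sa_set f.

(* A partial map from databases to relations ([None] meaning undefined) is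
   computable when a partial recursive function turns every description of a
   database into some description of its image, and diverges on every
   description of a database that has no image. *)
Definition computable (R : realType) sigma k
    (Q : database R sigma -> option (strelation R k)) : Prop :=
  exists m : recfun,
  forall (D : database R sigma)
         (d : forall r : relname sigma, sa_desc (9 * arity r)),
    (forall r, describes (d r) (D r)) ->
    let input := CodeSeq.code [seq sa_code (d r) | r <- enum (relname sigma)] in
    if Q D is Some A
    then exists2 f, describes f A & rec_eval m [:: input] (sa_code f)
    else forall y, ~ rec_eval m [:: input] y.

Record query (R : realType) (sigma : schema) (k : nat) := Query {
  query_fun :> database R sigma -> option (strelation R k);
  query_computable : computable query_fun }.

(* The group (AC_st, A_t). The affinities of the time line are those preserving
   the temporal order, i.e. t |-> alpha * t + beta with alpha > 0. *)
Record st_affinity (R : realType) := STAffinity {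
  aff_M : 'M[R]_2;
  aff_b : 'cV[R]_2;
  aff_c : 'cV[R]_2;
  aff_alpha : R;
  aff_beta : R;
  aff_M_unit : aff_M \in unitmx;
  aff_alpha_gt0 : 0 < aff_alpha }.

Section Action.
Variables (R : realType) (g : st_affinity R).

Definition act_point (p : stpoint R) : stpoint R :=
  (aff_M g *m p.1 + aff_b g + p.2 *: aff_c g,
   aff_alpha g * p.2 + aff_beta g).

Lemma act_cotemporal (t : triangle R) :
  let c := map_tuple act_point (corners t) in
  [forall i, forall j, (tnth c i).2 == (tnth c j).2].
Proof.
apply/forallP => i; apply/forallP => j; rewrite !tnth_map /=.
by rewrite (eqP (forallP (forallP (corners_cotemporal t) i) j)).
Qed.

Definition act_triangle (t : triangle R) : triangle R :=
  Triangle (act_cotemporal t).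

Definition act_set k (S : set (k.-tuple (triangle R))) :
  set (k.-tuple (triangle R)) := (fun T => map_tuple act_triangle T) @` S.

End Action.

(* [Q (g D) = g (Q D)], both sides being undefined or both being equal. As g has
   arbitrary real coefficients while semi-algebraic sets are given by integer
   polynomials, g D need not be a database: the equation is required whenever
   g D is some database D'. *)
Definition generic (R : realType) sigma k
    (Q : database R sigma -> option (strelation R k)) : Prop :=
  forall (g : st_affinity R) (D D' : database R sigma),
    (forall r, D' r = act_set g (D r) :> set _) ->
    omap (@strel_set R k) (Q D') = omap (fun S => act_set g (strel_set S)) (Q D).

(* First-order formulas with free variables in 'I_n over the atoms A. In [Ex]
   and [All] the bound variable is [ord0] and the others are shifted by one. *)
Inductive formula (A : nat -> Type) (n : nat) : Type :=
| Atom of A n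
| Not of formula A n
| And of formula A n & formula A n
| Or of formula A n & formula A n
| Ex of formula A n.+1
| All of formula A n.+1.

Fixpoint holds (A : nat -> Type) (X : Type)
    (sat : forall n, A n -> n.-tuple X -> Prop)
    n (f : formula A n) : n.-tuple X -> Prop :=
  match f with
  | Atom a => fun v => sat n a v
  | Not f1 => fun v => ~ holds sat f1 v
  | And f1 f2 => fun v => holds sat f1 v /\ holds sat f2 v
  | Or f1 f2 => fun v => holds sat f1 v \/ holds sat f2 v
  | Ex f1 => fun v => exists x, holds sat f1 (cons_tuple x v)
  | All f1 => fun v => forall x, holds sat f1 (cons_tuple x v)
  end.

(* FO(+, *, <, 0, 1) over the schema with a name of arity [9 * arity r] for
   every name [r] of sigma. *)
Inductive real_atom (sigma : schema) (n : nat) : Type :=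
| RPos of zpoly n
| RRel (r : relname sigma) of (9 * arity r).-tuple 'I_n.

Definition real_sat (R : realType) sigma (D : database R sigma) n
    (a : real_atom sigma n) (v : n.-tuple R) : Prop :=
  match a with
  | RPos p => 0 < zpoly_eval p v
  | RRel r i => (@coords R (arity r) @` D r) (map_tuple (tnth v) i)
  end.

Definition FO_real_expressible (R : realType) sigma k
    (Q : database R sigma -> option (strelation R k)) : Prop :=
  exists f : formula (real_atom sigma) (9 * k),
  forall D : database R sigma,
  exists2 S, Q D = Some S
           & @coords R k @` S = [set v | holds (@real_sat R sigma D) f v].

(* FO({PartOf^Cotemp, Before, SAS}) over sigma. *)
Inductive tri_atom (sigma : schema) (n : nat) : Type :=
| TEq of 'I_n & 'I_n
| TRel (r : relname sigma) of (arity r).-tuple 'I_n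
| TPartOf of 'I_n & 'I_n
| TBefore of 'I_n & 'I_n
| TSAS of 'I_n & 'I_n & 'I_n & 'I_n.

Definition tri_sat (R : realType) sigma (D : database R sigma) n
    (a : tri_atom sigma n) (v : n.-tuple (triangle R)) : Prop :=
  match a with
  | TEq i j => drawing (tnth v i) = drawing (tnth v j)
  | TRel r i => strel_set (D r) (map_tuple (tnth v) i)
  | TPartOf i j => PartOf_cotemp (tnth v i) (tnth v j)
  | TBefore i j => Before (tnth v i) (tnth v j)
  | TSAS i j k l => SAS (tnth v i) (tnth v j) (tnth v k) (tnth v l)
  end.

Definition FO_triangle_expressed (R : realType) sigma k
    (Q : database R sigma -> option (strelation R k)) : Prop :=
  exists f : formula (tri_atom sigma) k,
  forall D : database R sigma,
  exists2 S, Q D = Some S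
           & strel_set S = [set T | holds (@tri_sat R sigma D) f T].

(* Main.v *)
Require Import Defs.
From mathcomp Require Import all_boot all_order all_fingroup all_algebra.
From mathcomp Require Import boolp classical_sets reals.
From mathcomp Require Import ring lra zify.
From mathcomp.real_closed Require ordered_qelim qe_rcf.

(* Soundness: both languages are closed under the Boolean operations and
   quantifiers, and every atom is invariant and semi-algebraic.

   Completeness: reals are encoded as times of triangles. Relative to a frame of
   four point-triangles, SAS draws parallels in prescribed non-horizontal
   directions and Before recognizes cotemporal points, so addition and
   multiplication of times become incidence constructions. A triangle is
   determined up to the order of its corners by its drawing and its center of
   mass, which SAS identifies. Hence a real formula can be evaluated in the
   coordinates of any frame, and it remains to choose the frame by an
   existential quantifier.

   For this the formula must be invariant under every affinity, whereas
   genericity only speaks of affinities that map the database to a set given by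
   integer polynomials. So f is first replaced by f', where f'(D, T) says that
   the set E of the g for which T lies in the g-image of f's output on g^-1 D
   contains an open box. This is fully invariant because left translations are
   homeomorphisms of R^10. On databases f' and f agree: for rational g genericity
   tells whether g lies in E, and E is semi-algebraic by quantifier elimination, so
   that every box has a subbox inside E or disjoint from E, and this subbox
   contains rational points. *)

Set Implicit Arguments.
Unset Strict Implicit.
Unset Printing Implicit Defensive.

Import Order.TTheory GRing.Theory Num.Theory.

Local Open Scope classical_set_scope.
Local Open Scope ring_scope.

(** * Coordinates *)

Section Coordinates.
Variable R : realType.
Implicit Types (p q : stpoint R) (t : triangle R).

(** Guessing a frame is harmless because every frame is the image of the standard one under some
    affinity g: evaluating a formula in that frame amounts to evaluating it in the standard frame
    after moving database and tuple by g^-1. An invariant formula gives the same answer in all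
    frames. As g is arbitrary here, the moved relations need not be given by integer polynomials, so
    most of the work concerns structures of which only closure under corner permutations is
    required. That closure also absorbs the corner order, which the triangle language cannot see.

    Genericity settles membership in E only at those g that lead to databases, in particular the
    rational ones, and rationality is not first-order definable over the reals. Quantifying over all
    real g instead would not do, because f is unconstrained on structures that are not databases.
    Having nonempty interior is definable, is compatible with translations, and can be tested at
    rational points once E is known to be semi-algebraic in g, with the coordinates of T as real
    parameters. *)

Definition mkpt (x y s : R) : stpoint R :=
  (\col_(i < 2) (if i == ord0 then x else y), s).
Definition px p : R := p.1 ord0 ord0.
Definition py p : R := p.1 ord_max ord0.

Lemma px_mkpt x y s : px (mkpt x y s) = x. Proof. by rewrite /px mxE. Qed.
Lemma py_mkpt x y s : py (mkpt x y s) = y. Proof. by rewrite /py mxE. Qed.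

Lemma ord2P (i : 'I_2) : i = ord0 \/ i = ord_max.
Proof. by case: i => [[|[|//]] ?]; [left|right]; apply: val_inj. Qed.

Lemma eq_pt p q : px p = px q -> py p = py q -> p.2 = q.2 -> p = q.
Proof.
case: p q => [a s] [b s']; rewrite /px /py /= => e0 e1 ->; congr pair.
by apply/matrixP => i j; rewrite (ord1 j); case: (ord2P i) => ->.
Qed.

Lemma mkpt_eta p : mkpt (px p) (py p) p.2 = p.
Proof. by apply: eq_pt; rewrite ?px_mkpt ?py_mkpt. Qed.

Definition cor t (i : 'I_3) : stpoint R := tnth (corners t) i.

Lemma triangle_inj t t' : (forall i, cor t i = cor t' i) -> t = t'.
Proof.
case: t t' => [c h] [c' h'] H.
have e : c = c' by apply: eq_from_tnth => i; apply: H.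
by subst c'; congr Triangle; apply: eq_irrelevance.
Qed.

Lemma cor_time t i : (cor t i).2 = tri_time t.
Proof. exact/eqP/(forallP (forallP (corners_cotemporal t) i)). Qed.

Lemma mktri_subproof (x y : 'I_3 -> R) s :
  let c := [tuple mkpt (x i) (y i) s | i < 3] in
  [forall i, forall j, (tnth c i).2 == (tnth c j).2].
Proof. by apply/forallP => i; apply/forallP => j; rewrite !tnth_mktuple. Qed.

Definition mktri x y s : triangle R := Triangle (mktri_subproof x y s).

Lemma cor_mktri x y s i : cor (mktri x y s) i = mkpt (x i) (y i) s.
Proof. by rewrite /cor tnth_mktuple. Qed.

Lemma time_mktri x y s : tri_time (mktri x y s) = s.
Proof. by rewrite -(cor_time _ ord0) cor_mktri. Qed.

Lemma cor_perm t s i : cor (permute_corners t s) i = cor t (s i).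
Proof. by rewrite /cor tnth_mktuple. Qed.

Definition pttri p : triangle R := mktri (fun=> px p) (fun=> py p) p.2.

Lemma cor_pttri p i : cor (pttri p) i = p.
Proof. by rewrite cor_mktri mkpt_eta. Qed.

Lemma time_pttri p : tri_time (pttri p) = p.2.
Proof. exact: time_mktri. Qed.

Lemma drawingE t p : drawing t p <->
  p.2 = tri_time t /\ exists w : 'I_3 -> R,
    [/\ forall i, 0 <= w i, \sum_i w i = 1,
        px p = \sum_i w i * px (cor t i) & py p = \sum_i w i * py (cor t i)].
Proof.
have tE (w : 'I_3 -> R) : \sum_i w i = 1 ->
    \sum_i w i * (tnth (corners t) i).2 = tri_time t.
  move=> w1; under eq_bigr do rewrite -/(cor _ _) cor_time.
  by rewrite -big_distrl /= w1 mul1r.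
split=> [[w [w0 w1 e1 e2]]|[e [w [w0 w1 ex ey]]]].
  split; first by rewrite e2 tE.
  exists w; split=> //; rewrite /px /py e1 summxE;
  by apply: eq_bigr => i _; rewrite mxE.
exists w; split => //; last by rewrite tE.
apply/matrixP => i j; rewrite (ord1 j) summxE.
by case: (ord2P i) => ->; [rewrite -/(px p) ex|rewrite -/(py p) ey];
  apply: eq_bigr => k _; rewrite mxE.
Qed.

Lemma drawing_cor t i : drawing t (cor t i).
Proof.
apply/drawingE; split; first exact: cor_time.
exists (fun j => (j == i)%:R); split=> [j| | |].
- exact: ler0n.
- by rewrite (bigD1 i) //= eqxx big1 ?addr0 // => j /negPf ->.
- by rewrite (bigD1 i) //= eqxx mul1r big1 ?addr0 // => j /negPf ->; rewrite mul0r.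
- by rewrite (bigD1 i) //= eqxx mul1r big1 ?addr0 // => j /negPf ->; rewrite mul0r.
Qed.

Lemma drawing_pttri p : drawing (pttri p) = [set p].
Proof.
apply/seteqP; split=> q /=.
  move/drawingE => [e [w [_ w1 ex ey]]]; apply: eq_pt.
  - rewrite ex; under eq_bigr do rewrite cor_pttri.
    by rewrite -big_distrl /= w1 mul1r.
  - rewrite ey; under eq_bigr do rewrite cor_pttri.
    by rewrite -big_distrl /= w1 mul1r.
  - by rewrite e time_pttri.
by move=> ->; rewrite -{2}(cor_pttri p ord0); apply: drawing_cor.
Qed.

(** A convex combination of convex combinations is again one, the weights being multiplied like
    matrices. *)
Lemma drawing_sub t t' : (forall i, drawing t' (cor t i)) ->
  drawing t `<=` drawing t'.
Proof.
move=> H p /drawingE [e [w [w0 w1 ex ey]]]; apply/drawingE.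
have /boolp.choice [u Hu] : forall i, exists u : 'I_3 -> R, 
  [/\ forall j, 0 <= u j, \sum_j u j = 1,
   px (cor t i) = \sum_j u j * px (cor t' j) &
   py (cor t i) = \sum_j u j * py (cor t' j)].
  by move=> i; have /drawingE[_] := H i.
split.
  by rewrite e -(cor_time _ ord0); have /drawingE[-> _] := H ord0.
exists (fun j => \sum_i w i * u i j); split.
- by move=> j; apply: sumr_ge0 => i _; apply: mulr_ge0 => //; have [] := Hu i.
- rewrite exchange_big /= -[RHS]w1; apply: eq_bigr => i _.
  by rewrite -big_distrr /=; have [_ -> _ _] := Hu i; rewrite mulr1.
- rewrite ex; under [RHS]eq_bigr do rewrite big_distrl /=.
  rewrite exchange_big /=; apply: eq_bigr => i _.
  have [_ _ -> _] := Hu i; rewrite big_distrr /=.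
  by apply: eq_bigr => j _; rewrite mulrA.
- rewrite ey; under [RHS]eq_bigr do rewrite big_distrl /=.
  rewrite exchange_big /=; apply: eq_bigr => i _.
  have [_ _ _ ->] := Hu i; rewrite big_distrr /=.
  by apply: eq_bigr => j _; rewrite mulrA.
Qed.

Lemma PartOfE t t' : PartOf_cotemp t t' <-> forall i, drawing t' (cor t i).
Proof.
by split=> [H i|/drawing_sub//]; apply: H; apply: drawing_cor.
Qed.

Lemma drawing_perm t s : drawing (permute_corners t s) = drawing t.
Proof.
apply/seteqP; split; apply: drawing_sub => i.
  by rewrite cor_perm; apply: drawing_cor.
by have := drawing_cor (permute_corners t s) (s^-1%g i); rewrite cor_perm permKV.
Qed.

Definition cx t : R := 3^-1 * \sum_i px (cor t i).
Definition cy t : R := 3^-1 * \sum_i py (cor t i).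

(** Co-temporality makes the time of the center of mass the time of the triangle. With nonzero
    denominators the inequalities become strict and the fractions can be cross-multiplied, which
    leaves a polynomial condition. *)
Lemma SASE t1 t2 t3 t4 : SAS t1 t2 t3 t4 <->
  [/\ tri_time t1 < tri_time t2, tri_time t3 < tri_time t4,
   (cx t2 - cx t1) * (tri_time t4 - tri_time t3) =
     (cx t4 - cx t3) * (tri_time t2 - tri_time t1) &
   (cy t2 - cy t1) * (tri_time t4 - tri_time t3) =
     (cy t4 - cy t3) * (tri_time t2 - tri_time t1)].
Proof.
have tE t : 3^-1 * \sum_i (tnth (corners t) i).2 = tri_time t.
  under eq_bigr do rewrite -/(cor _ _) cor_time.
  by rewrite sumr_const card_ord -[tri_time t *+ 3]mulr_natl mulrA mulVf ?mul1r // pnatr_eq0.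
have xE t : (3^-1 *: \sum_i (tnth (corners t) i).1) ord0 ord0 = cx t.
  by rewrite mxE summxE.
have yE t : (3^-1 *: \sum_i (tnth (corners t) i).1) ord_max ord0 = cy t.
  by rewrite mxE summxE.
rewrite /SAS /= !tE; split.
  case=> [[le1 le2] n1 n2 H].
  split; [by rewrite lt_def -subr_eq0 n1|by rewrite lt_def -subr_eq0 n2| |].
    by have := H ord0; rewrite !xE => /eqP; rewrite eqr_div // => /eqP.
  by have := H ord_max; rewrite !yE => /eqP; rewrite eqr_div // => /eqP.
case=> lt1 lt2 ex ey; have n1 := lt_eqF lt1; have n2 := lt_eqF lt2.
have m1 : tri_time t2 - tri_time t1 != 0 by rewrite subr_eq0 eq_sym n1.
have m2 : tri_time t4 - tri_time t3 != 0 by rewrite subr_eq0 eq_sym n2.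
split; [by rewrite !ltW | by [] | by [] |] => i; apply/eqP.
by rewrite eqr_div //; case: (ord2P i) => ->; rewrite ?xE ?yE; apply/eqP.
Qed.

Definition tcoord t (i : nat) : R :=
  nth 0 (point_coords (cor t (inord (i %/ 3)%N))) (i %% 3)%N.

(** Position 2 alone supplies the time, so decoding is total; a vector that is not co-temporal is
    recognized by not being restored by re-encoding. *)
Definition dec9 (a : nat -> R) : triangle R :=
  mktri (fun i => a (3 * i)%N) (fun i => a (3 * i).+1) (a 2).

(* Coordinates 5 and 8 of a triangle repeat its time, which is coordinate 2. *)
Definition timeidx (i : nat) : nat :=
  if (i %% 9 == 5)%N || (i %% 9 == 8)%N then (9 * (i %/ 9) + 2)%N else i.

Lemma tcoordE t (j : 'I_3) : [/\ tcoord t (3 * j) = px (cor t j),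
  tcoord t (3 * j).+1 = py (cor t j) & tcoord t (3 * j).+2 = tri_time t].
Proof.
have e k : (k < 3)%N -> ((3 * j + k) %/ 3 = j)%N /\ ((3 * j + k) %% 3 = k)%N.
  by move=> k3; split; lia.
have [a0 b0] := e 0%N isT; have [a1 b1] := e 1%N isT; have [a2 b2] := e 2%N isT.
split.
- by rewrite -[(3 * j)%N]addn0 /tcoord a0 b0 inord_val.
- by rewrite -addn1 /tcoord a1 b1 inord_val.
- by rewrite -addn2 /tcoord a2 b2 inord_val /= cor_time.
Qed.

Lemma dec9_tcoord t : dec9 (tcoord t) = t.
Proof.
apply: triangle_inj => i; rewrite cor_mktri.
have [-> -> _] := tcoordE t i; have [_ _ e] := tcoordE t ord0.
by rewrite e -(cor_time t i) mkpt_eta.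
Qed.

Lemma tcoord_dec9 a i : (i < 9)%N -> tcoord (dec9 a) i = a (timeidx i).
Proof.
move=> i9; rewrite /tcoord cor_mktri.
have : (i %/ 3 < 3)%N by lia.
move=> H; rewrite inordK //.
by do 9 (case: i i9 H => [|i] //= i9 H; rewrite ?mxE //).
Qed.

Lemma eq_tcoord t t' : (forall i, (i < 9)%N -> tcoord t i = tcoord t' i) -> t = t'.
Proof.
move=> H; rewrite -(dec9_tcoord t) -(dec9_tcoord t').
apply: triangle_inj => i; rewrite !cor_mktri.
have i3 := ltn_ord i.
by rewrite (H (3 * i)%N) ?(H (3 * i).+1) ?(H 2%N) //; lia.
Qed.

Lemma nth_coords k (T : k.-tuple (triangle R)) (j : 'I_k) i : (i < 9)%N ->
  nth 0 (coords T) (9 * j + i) = tcoord (tnth T j) i.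
Proof.
have corE t : tval (corners t) = [:: cor t ord0; cor t (inord 1); cor t (inord 2)].
  rewrite /cor; case: (corners t) => -[|a [|b [|c []]]] //= ic.
  by rewrite !(tnth_nth a) /= !inordK.
have tE t m : (m < 9)%N ->
    nth 0 (flatten [seq tval (point_coords p) | p <- corners t]) m = tcoord t m.
  move=> m9; rewrite corE /tcoord /=.
  have H : ord0 = inord 0 :> 'I_3 by apply: val_inj; rewrite /= inordK.
  rewrite H.
  by do 9 (case: m m9 => [|m] //= m9); rewrite /=; congr (point_coords (cor t _)).2.
have sz t : size (flatten [seq tval (point_coords p) | p <- corners t]) = 9.
  by rewrite corE.
rewrite (tnth_nth (pttri (0, 0))) /= /coords_seq => i9.
have : (j < size T)%N by rewrite size_tuple.
move: (tval T) (nat_of_ord j) => s m.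
elim: s m => [|t s IH] [|m] //= lj; rewrite nth_cat sz.
  by rewrite muln0 add0n i9 tE.
have -> : (9 * m.+1 + i < 9)%N = false by apply/negbTE; lia.
have -> : (9 * m.+1 + i - 9 = 9 * m + i)%N by lia.
by rewrite IH.
Qed.

Lemma coordsE k (T : k.-tuple (triangle R)) i (lt_ik : (i %/ 9 < k)%N) :
  nth 0 (coords T) i = tcoord (tnth T (Ordinal lt_ik)) (i %% 9)%N.
Proof. by rewrite -nth_coords ?ltn_mod //= mulnC -divn_eq. Qed.

Lemma eq_coords k (v w : (9 * k).-tuple R) :
  (forall (j : 'I_k) i, (i < 9)%N -> nth 0 v (9 * j + i) = nth 0 w (9 * j + i)) ->
  v = w.
Proof.
move=> H; apply: eq_from_tnth => i; rewrite !(tnth_nth 0).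
have lt : (i %/ 9 < k)%N by have := ltn_ord i; lia.
have e : (9 * (i %/ 9) + i %% 9 = i)%N by lia.
by have := H (Ordinal lt) (i %% 9)%N (ltn_mod _ _); rewrite /= e.
Qed.

Lemma coords_inj k : injective (@coords R k).
Proof.
move=> T T' e; apply: eq_from_tnth => j; apply: eq_tcoord => i i9.
by rewrite -!nth_coords // e.
Qed.

Definition dec k (v : (9 * k).-tuple R) : k.-tuple (triangle R) :=
  [tuple dec9 (fun i => nth 0 v (9 * j + i)) | j < k].

Lemma decK k (T : k.-tuple (triangle R)) : dec (coords T) = T.
Proof.
apply: eq_from_tnth => j; rewrite tnth_mktuple; apply: triangle_inj => i.
have i3 := ltn_ord i; rewrite -[in RHS](dec9_tcoord (tnth T j)) !cor_mktri.
by rewrite (nth_coords T j (i := 3 * i)) ?(nth_coords T j (i := (3 * i).+1))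
  ?(nth_coords T j (i := 2)) //; lia.
Qed.

Lemma nth_coords_dec k (v : (9 * k).-tuple R) i : (i < 9 * k)%N ->
  nth 0 (coords (dec v)) i = nth 0 v (timeidx i).
Proof.
move=> ik; have lt : (i %/ 9 < k)%N by lia.
rewrite (coordsE _ lt) tnth_mktuple tcoord_dec9 ?ltn_mod //=; congr nth.
by rewrite /timeidx modn_mod; case: ifP => _; lia.
Qed.

Lemma image_coords k (S : set (k.-tuple (triangle R))) (v : (9 * k).-tuple R) :
  (@coords R k @` S) v <-> coords (dec v) = v /\ S (dec v).
Proof.
by split=> [[T ST <-]|[e ST]]; [rewrite decK|exists (dec v)].
Qed.

Lemma image_coordsE k (S : set (k.-tuple (triangle R))) T :
  (@coords R k @` S) (coords T) <-> S T.
Proof. by split=> [/image_coords[_]|ST]; [rewrite decK|exists T]. Qed.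

End Coordinates.

(** * The group action in coordinates *)

Section Action.
Variable R : realType.
Implicit Types (p q : stpoint R) (t : triangle R).

(* Group elements as 10-tuples of reals: the entries of M (row by row), of b
   and of c, then alpha and beta. Tuples that are not [valid] act as well. *)
Notation params := (10.-tuple R).
Implicit Types g h : params.

Definition valid g := 0 < g`_8 /\ g`_0 * g`_3 - g`_1 * g`_2 != 0.

Definition act_pt g p : stpoint R :=
  mkpt (g`_0 * px p + g`_1 * py p + g`_4 + p.2 * g`_6)
       (g`_2 * px p + g`_3 * py p + g`_5 + p.2 * g`_7)
       (g`_8 * p.2 + g`_9).

Definition act g t : triangle R :=
  mktri (fun i => px (act_pt g (cor t i))) (fun i => py (act_pt g (cor t i)))
        (g`_8 * tri_time t + g`_9).

Definition acts g k (T : k.-tuple (triangle R)) := map_tuple (act g) T.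

Lemma cor_act g t i : cor (act g t) i = act_pt g (cor t i).
Proof.
by rewrite cor_mktri; apply: eq_pt; rewrite ?px_mkpt ?py_mkpt //= cor_time.
Qed.

Lemma time_act g t : tri_time (act g t) = g`_8 * tri_time t + g`_9.
Proof. exact: time_mktri. Qed.

Definition gmul g h : params :=
  [tuple g`_0 * h`_0 + g`_1 * h`_2; g`_0 * h`_1 + g`_1 * h`_3;
         g`_2 * h`_0 + g`_3 * h`_2; g`_2 * h`_1 + g`_3 * h`_3;
         g`_0 * h`_4 + g`_1 * h`_5 + g`_4 + h`_9 * g`_6;
         g`_2 * h`_4 + g`_3 * h`_5 + g`_5 + h`_9 * g`_7;
         g`_0 * h`_6 + g`_1 * h`_7 + h`_8 * g`_6;
         g`_2 * h`_6 + g`_3 * h`_7 + h`_8 * g`_7;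
         g`_8 * h`_8; g`_8 * h`_9 + g`_9].

Definition gone : params := [tuple 1; 0; 0; 1; 0; 0; 0; 0; 1; 0].

(** Obtained by solving x' = Mx + b + tc, t' = alpha t + beta for (x, t): [c0] and [c1] are the
    entries of -M^-1 c / alpha, and substituting t = (t' - beta) / alpha adds -beta times them to
    -M^-1 b. *)
Definition ginv g : params :=
  let d := g`_0 * g`_3 - g`_1 * g`_2 in
  let c0 := - (g`_3 * g`_6 - g`_1 * g`_7) / d / g`_8 in
  let c1 := - (g`_0 * g`_7 - g`_2 * g`_6) / d / g`_8 in
  [tuple g`_3 / d; - g`_1 / d; - g`_2 / d; g`_0 / d;
         - (g`_3 * g`_4 - g`_1 * g`_5) / d - g`_9 * c0;
         - (g`_0 * g`_5 - g`_2 * g`_4) / d - g`_9 * c1;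
         c0; c1; (g`_8)^-1; - g`_9 / g`_8].

Lemma act_pt_mul g h p : act_pt (gmul g h) p = act_pt g (act_pt h p).
Proof. by apply: eq_pt; rewrite /act_pt /= ?(px_mkpt, py_mkpt) /=; ring. Qed.

Lemma act_pt_one p : act_pt gone p = p.
Proof. by apply: eq_pt; rewrite /act_pt /= ?(px_mkpt, py_mkpt) /=; ring. Qed.

Lemma act_mul g h t : act (gmul g h) t = act g (act h t).
Proof. by apply: triangle_inj => i; rewrite !cor_act act_pt_mul. Qed.

Lemma act_one t : act gone t = t.
Proof. by apply: triangle_inj => i; rewrite !cor_act act_pt_one. Qed.

Lemma params_eta g : g = [tuple g`_0; g`_1; g`_2; g`_3; g`_4; g`_5; g`_6; g`_7; g`_8; g`_9].
Proof.
apply: eq_from_tnth => i; rewrite !(tnth_nth 0).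
by case: i; do 10 (case=> //).
Qed.

Lemma gmulA g h l : gmul g (gmul h l) = gmul (gmul g h) l.
Proof.
by apply: val_inj; rewrite /=; congr [:: _; _; _; _; _; _; _; _; _; _]; ring.
Qed.

Lemma gmul1 g : gmul gone g = g.
Proof.
rewrite [in RHS](params_eta g); apply: val_inj; rewrite /=.
by congr [:: _; _; _; _; _; _; _; _; _; _]; ring.
Qed.

Lemma gmulVg g : valid g -> gmul (ginv g) g = gone.
Proof.
move=> [/lt0r_neq0 a0 d0]; apply: val_inj; rewrite /=.
by congr [:: _; _; _; _; _; _; _; _; _; _]; field; rewrite ?a0 ?d0.
Qed.

Lemma gmulgV g : valid g -> gmul g (ginv g) = gone.
Proof.
move=> [/lt0r_neq0 a0 d0]; apply: val_inj; rewrite /=.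
by congr [:: _; _; _; _; _; _; _; _; _; _]; field; rewrite ?a0 ?d0.
Qed.

Lemma valid_mul g h : valid g -> valid h -> valid (gmul g h).
Proof.
move=> [a0 d0] [a1 d1]; split=> /=; first exact: mulr_gt0.
rewrite (_ : _ - _ = (g`_0 * g`_3 - g`_1 * g`_2) * (h`_0 * h`_3 - h`_1 * h`_2)).
  by rewrite mulf_neq0.
ring.
Qed.

Lemma valid_inv g : valid g -> valid (ginv g).
Proof.
move=> [a0 d0]; split=> /=; first by rewrite invr_gt0.
set d := _ - _ in d0 *.
rewrite (_ : _ - _ = d^-1); first by rewrite invr_eq0.
by rewrite /d in d0 *; field; rewrite d0.
Qed.

Lemma actK g : valid g -> cancel (act g) (act (ginv g)).
Proof. by move=> vg t; rewrite -act_mul gmulVg // act_one. Qed.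

Lemma actVK g : valid g -> cancel (act (ginv g)) (act g).
Proof. by move=> vg t; rewrite -act_mul gmulgV // act_one. Qed.

Lemma act_ptK g : valid g -> cancel (act_pt g) (act_pt (ginv g)).
Proof. by move=> vg t; rewrite -act_pt_mul gmulVg // act_pt_one. Qed.

Lemma act_perm g t s : act g (permute_corners t s) = permute_corners (act g t) s.
Proof. by apply: triangle_inj => i; rewrite cor_act !cor_perm cor_act. Qed.

Lemma acts_mul g h k (T : k.-tuple (triangle R)) :
  acts (gmul g h) T = acts g (acts h T).
Proof. by apply: eq_from_tnth => i; rewrite !tnth_map act_mul. Qed.

Lemma acts_one k (T : k.-tuple (triangle R)) : acts gone T = T.
Proof. by apply: eq_from_tnth => i; rewrite !tnth_map act_one. Qed.

Lemma actsK g k : valid g -> cancel (@acts g k) (@acts (ginv g) k).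
Proof. by move=> vg T; rewrite -acts_mul gmulVg // acts_one. Qed.

Lemma actsVK g k : valid g -> cancel (@acts (ginv g) k) (@acts g k).
Proof. by move=> vg T; rewrite -acts_mul gmulgV // acts_one. Qed.

Lemma sum_aff (w x y : 'I_3 -> R) a b c : \sum_i w i = 1 ->
  a * (\sum_i w i * x i) + b * (\sum_i w i * y i) + c =
  \sum_i w i * (a * x i + b * y i + c).
Proof.
move=> w1; rewrite -[X in _ + X]mulr1 -w1 !big_distrr /= -!big_split /=.
by apply: eq_bigr => i _; ring.
Qed.

(** Time is constant on a triangle, so the shear by c is a translation there, and affine maps
    respect convex combinations. *)
Lemma drawing_act g t p : drawing t p -> drawing (act g t) (act_pt g p).
Proof.
move=> /drawingE[e [w [w0 w1 ex ey]]]; apply/drawingE.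
split; first by rewrite time_act /= e.
exists w; split=> //.
  rewrite px_mkpt ex ey -addrA sum_aff //; apply: eq_bigr => i _.
  by rewrite cor_act px_mkpt cor_time e addrA.
rewrite py_mkpt ex ey -addrA sum_aff //; apply: eq_bigr => i _.
by rewrite cor_act py_mkpt cor_time e addrA.
Qed.

Lemma PartOf_act g t t' : valid g ->
  PartOf_cotemp (act g t) (act g t') <-> PartOf_cotemp t t'.
Proof.
move=> vg; rewrite !PartOfE; split=> H i; have := H i; rewrite cor_act.
  by move/(@drawing_act (ginv g)); rewrite actK // act_ptK.
exact: drawing_act.
Qed.

Lemma drawing_eqE t t' : drawing t = drawing t' <->
  PartOf_cotemp t t' /\ PartOf_cotemp t' t.
Proof.
split=> [e|[H H']]; first by rewrite /PartOf_cotemp e; split.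
by apply/seteqP; split.
Qed.

Lemma Before_act g t t' : valid g -> Before (act g t) (act g t') <-> Before t t'.
Proof. by move=> [a0 _]; rewrite /Before !time_act lerD2r ler_pM2l. Qed.

Lemma cx_act g t : cx (act g t) =
  g`_0 * cx t + g`_1 * cy t + g`_4 + tri_time t * g`_6.
Proof.
rewrite /cx /cy; under eq_bigr do rewrite cor_act px_mkpt cor_time.
rewrite !big_split /= -!big_distrr /= !sumr_const card_ord.
by field.
Qed.

Lemma cy_act g t : cy (act g t) =
  g`_2 * cx t + g`_3 * cy t + g`_5 + tri_time t * g`_7.
Proof.
rewrite /cx /cy; under eq_bigr do rewrite cor_act py_mkpt cor_time.
rewrite !big_split /= -!big_distrr /= !sumr_const card_ord.
by field.
Qed.

(** A velocity v becomes (Mv + c) / alpha, so equal velocities stay equal; the inverse affinity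
    gives the converse. *)
Lemma SAS_act g t1 t2 t3 t4 : valid g ->
  SAS (act g t1) (act g t2) (act g t3) (act g t4) <-> SAS t1 t2 t3 t4.
Proof.
suff H h a1 a2 a3 a4 : valid h -> SAS a1 a2 a3 a4 ->
    SAS (act h a1) (act h a2) (act h a3) (act h a4).
  move=> vg; split; last exact: H.
  by move/(H _ _ _ _ _ (valid_inv vg)); rewrite !actK.
move=> [a0 _] /SASE[l1 l2 ex ey]; apply/SASE; rewrite !cx_act !cy_act !time_act.
split; rewrite ?ltrD2r ?ltr_pM2l //; apply/eqP; rewrite -subr_eq0; apply/eqP.
  (* The shear adds the same term to both sides, so c cancels in their difference. *)
  rewrite (_ : _ - _ = h`_8 *
   (h`_0 * ((cx a2 - cx a1) * (tri_time a4 - tri_time a3) -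
           (cx a4 - cx a3) * (tri_time a2 - tri_time a1)) +
   h`_1 * ((cy a2 - cy a1) * (tri_time a4 - tri_time a3) -
           (cy a4 - cy a3) * (tri_time a2 - tri_time a1)))); last by ring.
  by rewrite ex ey !subrr !mulr0 addr0 mulr0.
rewrite (_ : _ - _ = h`_8 *
   (h`_2 * ((cx a2 - cx a1) * (tri_time a4 - tri_time a3) -
           (cx a4 - cx a3) * (tri_time a2 - tri_time a1)) +
   h`_3 * ((cy a2 - cy a1) * (tri_time a4 - tri_time a3) -
           (cy a4 - cy a3) * (tri_time a2 - tri_time a1)))); last by ring.
by rewrite ex ey !subrr !mulr0 addr0 mulr0.
Qed.

Definition params_of (g : st_affinity R) : params :=
  [tuple aff_M g ord0 ord0; aff_M g ord0 ord_max;
         aff_M g ord_max ord0; aff_M g ord_max ord_max;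
         aff_b g ord0 ord0; aff_b g ord_max ord0;
         aff_c g ord0 ord0; aff_c g ord_max ord0; aff_alpha g; aff_beta g].

Lemma det2 (M : 'M[R]_2) : \det M =
  M ord0 ord0 * M ord_max ord_max - M ord0 ord_max * M ord_max ord0.
Proof.
have e1 : 1 = ord_max :> 'I_2 by apply: val_inj.
by rewrite (expand_det_row _ ord0) !big_ord_recl big_ord0 /cofactor !det_mx11 !mxE /=
  ?addr0 ?add0n ?expr0 ?expr1 ?mul1r ?mulN1r ?mulrN //;
  congr (M _ _ * M _ _ - M _ _ * M _ _); apply: val_inj.
Qed.

Lemma valid_params_of (g : st_affinity R) : valid (params_of g).
Proof.
split=> /=; first exact: aff_alpha_gt0.
by have := aff_M_unit g; rewrite unitmxE unitfE det2.
Qed.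

Lemma act_params_of (g : st_affinity R) t : act (params_of g) t = act_triangle g t.
Proof.
apply: triangle_inj => i; rewrite cor_act /cor tnth_map.
apply: eq_pt; rewrite ?px_mkpt ?py_mkpt //= /px /py !mxE !big_ord_recl big_ord0 addr0;
  do 3 congr (_ + _); congr (_ * _); congr (_ _ _); exact: val_inj.
Qed.

Lemma params_of_surj h : valid h -> exists g : st_affinity R, params_of g = h.
Proof.
move=> [a0 d0].
pose M : 'M[R]_2 := \matrix_(i, j) nth 0 h (2 * i + j).
have uM : M \in unitmx by rewrite unitmxE unitfE det2 !mxE.
exists (STAffinity (\col_i nth 0 h (4 + i)) (\col_i nth 0 h (6 + i)) h`_9 uM a0).
by rewrite [RHS]params_eta; apply: val_inj; rewrite /= !mxE.
Qed.

End Action.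

(** * Permutation-invariant structures *)

Section Structures.
Variables (R : realType) (sigma : schema).

(** Databases are too few: an affinity with arbitrary real coefficients need not preserve
    semi-algebraicity over the integers. These structures are stable under the whole group and keep
    the property of databases that hides the order of corners. *)
Record pstruct := PStruct {
  ps_set : forall r : relname sigma, set ((arity r).-tuple (triangle R));
  ps_perm : forall r (T : (arity r).-tuple (triangle R)) (s : 'I_(arity r) -> 'S_3),
    ps_set T -> ps_set [tuple permute_corners (tnth T i) (s i) | i < arity r] }.

Definition of_db (D : database R sigma) : pstruct :=
  @PStruct (fun r => strel_set (D r)) (fun r => @strel_perm R _ (D r)).

Lemma pull_subproof (g : 10.-tuple R) (D : pstruct) r
    (T : (arity r).-tuple (triangle R)) (s : 'I_(arity r) -> 'S_3) :
  ps_set D (acts g T) ->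
  ps_set D (acts g [tuple permute_corners (tnth T i) (s i) | i < arity r]).
Proof.
move/(ps_perm s); congr (ps_set D _); apply: eq_from_tnth => i.
by rewrite !(tnth_map, tnth_mktuple) act_perm.
Qed.

(* For valid [g] this is the image of [D] under the inverse of [g]. *)
Definition pull (g : 10.-tuple R) (D : pstruct) : pstruct :=
  PStruct (@pull_subproof g D).

Lemma eq_pstruct (D D' : pstruct) :
  (forall r (T : (arity r).-tuple (triangle R)), ps_set D T <-> ps_set D' T) -> D = D'.
Proof.
case: D D' => [S p] [S' p'] /= H.
have e : S = S'.
  by apply: functional_extensionality_dep => r; apply/seteqP; split=> T; move/H.
by subst S'; congr PStruct; apply: Prop_irrelevance.
Qed.

Lemma pull_mul g h (D : pstruct) : pull h (pull g D) = pull (gmul g h) D.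
Proof. by apply: eq_pstruct => r T /=; rewrite acts_mul. Qed.

Lemma pull_one (D : pstruct) : pull (gone R) D = D.
Proof. by apply: eq_pstruct => r T /=; rewrite acts_one. Qed.

Definition tri_psat (D : pstruct) n (a : tri_atom sigma n)
    (v : n.-tuple (triangle R)) : Prop :=
  match a with
  | TEq i j => drawing (tnth v i) = drawing (tnth v j)
  | TRel r i => ps_set D (map_tuple (tnth v) i)
  | TPartOf i j => PartOf_cotemp (tnth v i) (tnth v j)
  | TBefore i j => Before (tnth v i) (tnth v j)
  | TSAS i j k l => SAS (tnth v i) (tnth v j) (tnth v k) (tnth v l)
  end.

Definition real_psat (D : pstruct) n (a : real_atom sigma n) (v : n.-tuple R) : Prop :=
  match a with
  | RPos p => 0 < zpoly_eval p v
  | RRel r i => (@coords R (arity r) @` @ps_set D r) (map_tuple (tnth v) i)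
  end.

Lemma acts_cons g n (t : triangle R) (v : n.-tuple (triangle R)) :
  acts g (cons_tuple t v) = cons_tuple (act g t) (acts g v).
Proof. exact: val_inj. Qed.

(** [act g] is an isomorphism between the two structures, and quantifiers range over all triangles,
    which it permutes; witnesses are carried back by [ginv g]. *)
Lemma holds_pull g (D : pstruct) n (f : formula (tri_atom sigma) n)
    (v : n.-tuple (triangle R)) : valid g ->
  holds (@tri_psat (pull g D)) f v <-> holds (@tri_psat D) f (acts g v).
Proof.
move=> vg; elim: n / f v => [n [i j|r i|i j|i j|i j k l]|n f IH|n f IHf h IHh|
  n f IHf h IHh|n f IH|n f IH] v /=.
- by rewrite !tnth_map !drawing_eqE !PartOf_act.
- suff -> : acts g (map_tuple (tnth v) i) = map_tuple (tnth (acts g v)) i by [].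
  by apply: eq_from_tnth => j; rewrite !tnth_map.
- by rewrite !tnth_map PartOf_act.
- by rewrite !tnth_map Before_act.
- by rewrite !tnth_map SAS_act.
- by rewrite IH.
- by rewrite IHf IHh.
- by rewrite IHf IHh.
- split=> [[t /IH]|[t Ht]]; first by rewrite acts_cons; exists (act g t).
  by exists (act (ginv g) t); apply/IH; rewrite acts_cons actVK.
- split=> [H t|H t]; last by apply/IH; rewrite acts_cons.
  by have /IH := H (act (ginv g) t); rewrite acts_cons actVK.
Qed.

End Structures.

(** * Definable families of relations *)

Section Definable.
Variables (A : nat -> Type) (X S : Type).
Variable sat : S -> forall n, A n -> n.-tuple X -> Prop.
Variable some_atom : forall n, A n.+1.

Section Context.
Variables (C : Type) (N : nat) (e : C -> N.-tuple X).
Implicit Types P : S -> C -> Prop.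

(** Predicates live on an arbitrary type C of contexts whose variables are exposed by e, so that
    formulas can be assembled by combinators that follow the shape of a Rocq proposition. *)
Definition definable P :=
  exists f : formula A N, forall D c, holds (@sat D) f (e c) <-> P D c.

Definition isvar (a : C -> X) := exists i, forall c, a c = tnth (e c) i.

Lemma isvar_eq a b : (forall c, a c = b c) -> isvar a -> isvar b.
Proof. by move=> ab [i Hi]; exists i => c; rewrite -ab. Qed.

Lemma def_eqv P Q : (forall D c, P D c <-> Q D c) -> definable P -> definable Q.
Proof. by move=> PQ [f Hf]; exists f => D c; rewrite Hf. Qed.

Lemma def_not P : definable P -> definable (fun D c => ~ P D c).
Proof. by move=> [f Hf]; exists (Not f) => D c /=; rewrite Hf. Qed.

Lemma def_and P Q : definable P -> definable Q ->
  definable (fun D c => P D c /\ Q D c).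
Proof. by move=> [f Hf] [h Hh]; exists (And f h) => D c /=; rewrite Hf Hh. Qed.

Lemma def_or P Q : definable P -> definable Q ->
  definable (fun D c => P D c \/ Q D c).
Proof. by move=> [f Hf] [h Hh]; exists (Or f h) => D c /=; rewrite Hf Hh. Qed.

Lemma def_imp P Q : definable P -> definable Q ->
  definable (fun D c => P D c -> Q D c).
Proof.
move=> dP dQ; apply: (def_eqv _ (def_or (def_not dP) dQ)) => D c.
split=> [[]//|PQ]; have [p|] := pselect (P D c); [right|left] => //; exact: PQ.
Qed.

(** Formulas have no constant for truth, and an atom may require a variable; the universal
    quantifier provides one even when N = 0. *)
Lemma def_True : definable (fun _ _ => True).
Proof.
exists (All (Or (Atom (some_atom N)) (Not (Atom (some_atom N))))) => D c /=.
by split=> // _ x; apply: EM.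
Qed.

Lemma def_forall (I : finType) (P : I -> S -> C -> Prop) :
  (forall i, definable (P i)) -> definable (fun D c => forall i, P i D c).
Proof.
move=> dP; suff [f Hf] : definable (fun D c => forall i, i \in enum I -> P i D c).
  by exists f => D c; rewrite Hf; split=> [H i|H i _] //; apply: H; rewrite mem_enum.
elim: (enum I) => [|i s IH]; first exact: def_eqv def_True.
apply: (def_eqv _ (def_and (dP i) IH)) => D c; split=> [[Hi H] j|H].
  by rewrite inE => /predU1P[->|/H].
by split=> [|j js]; apply: H; rewrite inE ?eqxx ?js ?orbT.
Qed.

End Context.

Definition ctx1 C N (e : C -> N.-tuple X) (xc : X * C) : N.+1.-tuple X :=
  cons_tuple xc.1 (e xc.2).
Definition ctxs m C N (e : C -> N.-tuple X) (xc : m.-tuple X * C) :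
  (m + N).-tuple X := cat_tuple xc.1 (e xc.2).

Section Quantifiers.
Variables (C : Type) (N : nat) (e : C -> N.-tuple X).

Lemma isvar_new : isvar (ctx1 e) fst.
Proof. by exists ord0 => c. Qed.

Lemma isvar_ctx1 a : isvar e a -> isvar (ctx1 e) (fun xc => a xc.2).
Proof. by move=> [i Hi]; exists (lift ord0 i) => c; rewrite tnthS. Qed.

Lemma isvar_ctxs m a : isvar e a -> isvar (@ctxs m _ _ e) (fun xc => a xc.2).
Proof. by move=> [i Hi]; exists (rshift m i) => c; rewrite tnth_rshift. Qed.

Lemma isvar_news m i : isvar (@ctxs m _ _ e) (fun xc => tnth xc.1 i).
Proof. by exists (lshift N i) => c; rewrite tnth_lshift. Qed.

Lemma def_ex (P : S -> X -> C -> Prop) :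
  definable (ctx1 e) (fun D xc => P D xc.1 xc.2) ->
  definable e (fun D c => exists x, P D x c).
Proof.
move=> [f Hf]; exists (Ex f) => D c /=.
by split=> -[x Hx]; exists x; apply/(Hf D (x, c)).
Qed.

Lemma def_all (P : S -> X -> C -> Prop) :
  definable (ctx1 e) (fun D xc => P D xc.1 xc.2) ->
  definable e (fun D c => forall x, P D x c).
Proof.
move=> [f Hf]; exists (All f) => D c /=.
by split=> H x; apply/(Hf D (x, c)); apply: H.
Qed.

End Quantifiers.

Lemma def_exs m C N (e : C -> N.-tuple X) (P : S -> m.-tuple X -> C -> Prop) :
  definable (@ctxs m _ _ e) (fun D xc => P D xc.1 xc.2) ->
  definable e (fun D c => exists x, P D x c).
Proof.
elim: m C N e P => [|m IH] C N e P [f Hf].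
  exists f => D c; rewrite -(_ : ctxs e ([tuple], c) = e c); last exact: val_inj.
  by rewrite Hf; split=> [|[x]]; [exists [tuple]|rewrite (tuple0 x)].
(* The head of the tuple is quantified innermost, so that it receives index 0, in front of the other
   m variables. *)
apply: (@def_eqv _ _ _ (fun D c => exists w : m.-tuple X, exists x,
    P D (cons_tuple x w) c)) => [D c|].
  split=> [[w [x]]|[w]]; first by exists (cons_tuple x w).
  by case/tupleP: w => x w; exists w, x.
apply: IH; exists (Ex f) => D [w c] /=.
split=> -[x Hx]; exists x; move: Hx; rewrite -(Hf D (cons_tuple x w, c));
  by congr (holds _ _ _); apply: val_inj.
Qed.

Lemma def_alls m C N (e : C -> N.-tuple X) (P : S -> m.-tuple X -> C -> Prop) :
  definable (@ctxs m _ _ e) (fun D xc => P D xc.1 xc.2) ->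
  definable e (fun D c => forall x, P D x c).
Proof.
move=> dP.
apply: (@def_eqv _ _ _ (fun D c => ~ exists x, ~ P D x c)) => [D c|].
  by split=> [H x|H [x]]; [apply: contrapT => nP; apply: H; exists x|].
by apply: def_not; apply: def_exs; apply: def_not.
Qed.

End Definable.

(** * Combinators for real formulas: polynomial terms, comparisons, relation atoms *)

Section RealDefinable.
Variables (R : realType) (sigma : schema).

Notation rdef := (@definable (real_atom sigma) R (pstruct R sigma) (@real_psat R sigma)).

Definition some_real_atom n : real_atom sigma n := RPos sigma ZZero.

Lemma rdef_forall C N (e : C -> N.-tuple R) n
    (P : 'I_n -> pstruct R sigma -> C -> Prop) :
  (forall i, rdef e (P i)) -> rdef e (fun D c => forall i, P i D c).
Proof. exact: def_forall (fun n => some_real_atom n.+1) _ _ _ _ _. Qed.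

Inductive isterm C N (e : C -> N.-tuple R) : (C -> R) -> Prop :=
| term_var a of isvar e a : isterm e a
| term0 : isterm e (fun=> 0)
| term1 : isterm e (fun=> 1)
| termN a of isterm e a : isterm e (fun c => - a c)
| termD a b of isterm e a & isterm e b : isterm e (fun c => a c + b c)
| termM a b of isterm e a & isterm e b : isterm e (fun c => a c * b c)
| term_eq a b of (forall c, a c = b c) & isterm e a : isterm e b.

Section Context.
Variables (C : Type) (N : nat) (e : C -> N.-tuple R).
Implicit Types a b : C -> R.

Lemma term_ctxs m a : isterm e a -> isterm (@ctxs R m C N e) (fun xc => a xc.2).
Proof.
elim=> {a}[a va||||||a b ab _ tb]; try by constructor.
- by constructor; apply: isvar_ctxs.
- by apply: term_eq tb => c; apply: ab.
Qed.

Lemma termP a : isterm e a ->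
  exists p : zpoly N, forall c, zpoly_eval p (e c) = a c.
Proof.
elim=> {a}[a [i Hi]|||a _ [p Hp]|a b _ [p Hp] _ [q Hq]|a b _ [p Hp] _ [q Hq]|
  a b ab _ [p Hp]].
- by exists (ZVar i) => c; rewrite Hi.
- by exists ZZero.
- by exists ZOne.
- by exists (ZOpp p) => c /=; rewrite Hp.
- by exists (ZAdd p q) => c /=; rewrite Hp Hq.
- by exists (ZMul p q) => c /=; rewrite Hp Hq.
- by exists p => c; rewrite Hp.
Qed.

Lemma termB a b : isterm e a -> isterm e b -> isterm e (fun c => a c - b c).
Proof. by move=> ta tb; apply: termD => //; apply: termN. Qed.

Lemma term_sum I (s : seq I) (a : I -> C -> R) : (forall i, isterm e (a i)) ->
  isterm e (fun c => \sum_(i <- s) a i c).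
Proof.
move=> ta; elim: s => [|i s IH].
  by apply: term_eq (term0 e) => c; rewrite big_nil.
by apply: term_eq (termD (ta i) IH) => c; rewrite big_cons.
Qed.

Lemma def_pos a : isterm e a -> rdef e (fun _ c => 0 < a c).
Proof. by move=> /termP[p Hp]; exists (Atom (RPos sigma p)) => D c /=; rewrite Hp. Qed.

Lemma def_lt a b : isterm e a -> isterm e b -> rdef e (fun _ c => a c < b c).
Proof.
move=> ta tb; apply: (def_eqv _ (def_pos (termB tb ta))) => D c.
by rewrite subr_gt0.
Qed.

Lemma def_le a b : isterm e a -> isterm e b -> rdef e (fun _ c => a c <= b c).
Proof.
move=> ta tb; apply: (def_eqv _ (def_not (def_lt tb ta))) => D c.
by rewrite leNgt; split=> [/negP|/negP].
Qed.

Lemma def_eq a b : isterm e a -> isterm e b -> rdef e (fun _ c => a c = b c).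
Proof.
move=> ta tb; apply: (def_eqv _ (def_and (def_le ta tb) (def_le tb ta))) => D c.
by split=> [[ab ba]|->//]; apply/eqP; rewrite eq_le ab.
Qed.

End Context.

(** Relation atoms accept variables only, so the terms are first named by quantified variables. *)
Lemma def_rel C N (e : C -> N.-tuple R) (r : relname sigma)
    (w : C -> (9 * arity r).-tuple R) :
  (forall i, isterm e (fun c => tnth (w c) i)) ->
  rdef e (fun D c => (@coords R _ @` @ps_set _ _ D r) (w c)).
Proof.
move=> tw; apply: (@def_eqv _ _ _ _ _ _ _ (fun D c => exists u,
    (forall i, tnth u i = tnth (w c) i) /\ (@coords R _ @` @ps_set _ _ D r) u)).
  move=> D c; split=> [[u [uw]]|H]; last by exists (w c).
  by rewrite (_ : u = w c) //; apply: eq_from_tnth.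
apply: def_exs; apply: def_and.
  apply: rdef_forall => i; apply: def_eq.
    by constructor; apply: isvar_news.
  exact: (term_ctxs _ (tw i)).
exists (Atom (RRel [tuple lshift N i | i < 9 * arity r])) => D [u c] /=.
rewrite (_ : map_tuple _ _ = u) //; apply: eq_from_tnth => i.
by rewrite tnth_map tnth_mktuple tnth_lshift.
Qed.

End RealDefinable.

(** * Soundness *)

Section Soundness.
Variables (R : realType) (sigma : schema).

Notation rdef := (@definable (real_atom sigma) R (pstruct R sigma) (@real_psat R sigma)).

(** A triangle variable is represented by real variables for its nine coordinates; the three copies
    of the time may be one and the same variable. *)
Definition tvar C N (e : C -> N.-tuple R) (t : C -> triangle R) :=
  forall i, (i < 9)%N -> isvar e (fun c => tcoord (t c) i).

Section Context.
Variables (C : Type) (N : nat) (e : C -> N.-tuple R).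
Implicit Types t : C -> triangle R.

Lemma tvar_cor t i : tvar e t ->
  [/\ isterm e (fun c => px (cor (t c) i)), isterm e (fun c => py (cor (t c) i))
    & isterm e (fun c => tri_time (t c))].
Proof.
move=> vt; have i3 := ltn_ord i; split; constructor.
- by apply: isvar_eq (vt (3 * i)%N _) => [c|]; [have [] := tcoordE (t c) i|lia].
- by apply: isvar_eq (vt (3 * i).+1 _) => [c|]; [have [] := tcoordE (t c) i|lia].
- by apply: isvar_eq (vt (3 * i).+2 _) => [c|]; [have [] := tcoordE (t c) i|lia].
Qed.

Lemma tvar_ctxs m t : tvar e t -> tvar (@ctxs R m C N e) (fun xc => t xc.2).
Proof. by move=> vt i i9; exact: (isvar_ctxs _ (vt i i9)). Qed.

Lemma tvar_dec9 (a : nat -> C -> R) : (forall i, (i < 9)%N -> isvar e (a i)) ->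
  tvar e (fun c => dec9 (a^~ c)).
Proof.
move=> va i i9; apply: (@isvar_eq _ _ _ _ (a (timeidx i))).
  by move=> c; rewrite tcoord_dec9.
by apply: va; rewrite /timeidx; case: ifP; lia.
Qed.

Lemma def_drawing t t' i : tvar e t -> tvar e t' ->
  rdef e (fun _ c => drawing (t c) (cor (t' c) i)).
Proof.
move=> vt vt'; apply: (@def_eqv _ _ _ _ _ _ _ (fun D c =>
  tri_time (t' c) = tri_time (t c) /\ exists w : 3.-tuple R,
    ((forall j, 0 <= tnth w j) /\ \sum_j tnth w j = 1) /\
    (px (cor (t' c) i) = \sum_j tnth w j * px (cor (t c) j) /\
     py (cor (t' c) i) = \sum_j tnth w j * py (cor (t c) j)))).
  move=> D c; rewrite drawingE cor_time; split=> -[-> [w]].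
    by move=> [[w0 w1] [ex ey]]; split=> //; exists (tnth w).
  move=> [w0 w1 ex ey]; split=> //; exists [tuple w j | j < 3].
  split; split.
  - by move=> j; rewrite tnth_mktuple.
  - by under eq_bigr do rewrite tnth_mktuple.
  - by under eq_bigr do rewrite tnth_mktuple.
  - by under eq_bigr do rewrite tnth_mktuple.
have [tx' ty' tt'] := tvar_cor i vt'.
have H j := tvar_cor j vt.
apply: def_and; first by apply: def_eq => //; have [] := H i.
apply: def_exs; apply: def_and; apply: def_and.
- apply: rdef_forall => j.
  by apply: def_le; [apply: term0|constructor; apply: isvar_news].
- apply: def_eq; last exact: term1.
  by apply: term_sum => j; constructor; apply: isvar_news.
- apply: def_eq; first exact: (term_ctxs _ tx').
  apply: term_sum => j; apply: termM; first by constructor; apply: isvar_news.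
  by have [/(term_ctxs 3)] := H j.
- apply: def_eq; first exact: (term_ctxs _ ty').
  apply: term_sum => j; apply: termM; first by constructor; apply: isvar_news.
  by have [_ /(term_ctxs 3)] := H j.
Qed.

Lemma def_PartOf t t' : tvar e t -> tvar e t' ->
  rdef e (fun _ c => PartOf_cotemp (t c) (t' c)).
Proof.
move=> vt vt'; apply: (@def_eqv _ _ _ _ _ _ _ (fun D c =>
  forall i, drawing (t' c) (cor (t c) i))); first by move=> D c; rewrite PartOfE.
by apply: rdef_forall => i; apply: def_drawing.
Qed.

Lemma def_SAS t1 t2 t3 t4 : tvar e t1 -> tvar e t2 -> tvar e t3 -> tvar e t4 ->
  rdef e (fun _ c => SAS (t1 c) (t2 c) (t3 c) (t4 c)).
Proof.
move=> v1 v2 v3 v4.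
(* Integer polynomials have no coefficient 1/3, so three times the center is used; the factor
   cancels in both equations. *)
pose sx t c := \sum_i px (cor (t c) i); pose sy t c := \sum_i py (cor (t c) i).
have tx t : tvar e t -> isterm e (sx t).
  by move=> vt; apply: term_sum => i; have [] := tvar_cor i vt.
have ty t : tvar e t -> isterm e (sy t).
  by move=> vt; apply: term_sum => i; have [] := tvar_cor i vt.
have tt t : tvar e t -> isterm e (fun c => tri_time (t c)).
  by move=> vt; have [] := tvar_cor ord0 vt.
apply: (@def_eqv _ _ _ _ _ _ _ (fun D c =>
  (tri_time (t1 c) < tri_time (t2 c) /\ tri_time (t3 c) < tri_time (t4 c)) /\
  ((sx t2 c - sx t1 c) * (tri_time (t4 c) - tri_time (t3 c)) =
     (sx t4 c - sx t3 c) * (tri_time (t2 c) - tri_time (t1 c)) /\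
   (sy t2 c - sy t1 c) * (tri_time (t4 c) - tri_time (t3 c)) =
     (sy t4 c - sy t3 c) * (tri_time (t2 c) - tri_time (t1 c))))).
  have n3 : (3 : R) != 0 by rewrite pnatr_eq0.
  move=> D c; rewrite SASE /cx /cy -/(sx t1 c) -/(sx t2 c) -/(sx t3 c) -/(sx t4 c)
    -/(sy t1 c) -/(sy t2 c) -/(sy t3 c) -/(sy t4 c) -!mulrBr -!mulrA.
  split=> [[[l1 l2] [-> ->]]//|[l1 l2 ex ey]].
  by split; split=> //; apply: (mulfI (x := 3^-1)); rewrite ?invr_eq0.
by apply: def_and; apply: def_and; [apply: def_lt|apply: def_lt|apply: def_eq|apply: def_eq];
  rewrite //; try apply: termM; try apply: termB; auto.
Qed.

End Context.

Lemma dec9_tuple (t : triangle R) :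
  dec9 (fun i => nth 0 [tuple tcoord t i | i < 9] i) = t.
Proof.
apply: eq_tcoord => i i9; rewrite tcoord_dec9 // -[in RHS](dec9_tcoord t) tcoord_dec9 //.
have i9' : (timeidx i < 9)%N by rewrite /timeidx; case: ifP; lia.
by rewrite -(tnth_nth 0 _ (Ordinal i9')) tnth_mktuple.
Qed.

(** A triangle quantifier becomes nine real quantifiers. As [dec9] is total and onto, every choice
    of nine reals denotes a triangle and every triangle is reached, which takes the place of a guard
    for co-temporality. *)
Lemma def_holds_tri n (f : formula (tri_atom sigma) n) C N (e : C -> N.-tuple R)
    (rho : C -> n.-tuple (triangle R)) :
  (forall j, tvar e (fun c => tnth (rho c) j)) ->
  rdef e (fun D c => holds (@tri_psat R sigma D) f (rho c)).
Proof.
elim: n / f C N e rho => [n [i j|r i|i j|i j|i j k l]|n f IH|n f IHf h IHh|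
  n f IHf h IHh|n f IH|n f IH] C N e rho v /=.
- apply: (@def_eqv _ _ _ _ _ _ _ (fun D c => PartOf_cotemp (tnth (rho c) i) (tnth (rho c) j) /\
    PartOf_cotemp (tnth (rho c) j) (tnth (rho c) i))).
    by move=> D c; rewrite drawing_eqE.
  by apply: def_and; apply: def_PartOf.
- apply: (@def_eqv _ _ _ _ _ _ _ (fun D c =>
    (@coords R _ @` @ps_set _ _ D r) (coords (map_tuple (tnth (rho c)) i)))).
    by move=> D c; rewrite image_coordsE.
  apply: def_rel => j; constructor.
  have lt : (j %/ 9 < arity r)%N by have := ltn_ord j; lia.
  apply: isvar_eq (v (tnth i (Ordinal lt)) (j %% 9)%N _); last exact: ltn_mod.
  by move=> c; rewrite [RHS](tnth_nth 0) (coordsE _ lt) tnth_map.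
- exact: def_PartOf.
- have [_ _ ti] := tvar_cor ord0 (v i); have [_ _ tj] := tvar_cor ord0 (v j).
  exact: def_le.
- exact: def_SAS.
- by apply: def_not; apply: IH.
- by apply: def_and; [apply: IHf|apply: IHh].
- by apply: def_or; [apply: IHf|apply: IHh].
- apply: (@def_eqv _ _ _ _ _ _ _ (fun D c => exists w : 9.-tuple R,
    holds (@tri_psat R sigma D) f (cons_tuple (dec9 (fun i => nth 0 w i)) (rho c)))).
    move=> D c; split=> [[w Hw]|[t Ht]]; first by exists (dec9 (fun i => nth 0 w i)).
    by exists [tuple tcoord t i | i < 9]; rewrite dec9_tuple.
  apply: def_exs; apply: IH => j.
  case: (unliftP ord0 j) => [j'|] -> i i9.
    apply: (@isvar_eq _ _ _ _ (fun xc => tcoord (tnth (rho xc.2) j') i)).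
      by move=> c; rewrite tnthS.
    exact: (@tvar_ctxs _ _ _ 9 _ (v j') i i9).
  apply: (@tvar_dec9 _ _ _ (fun i (xc : 9.-tuple R * C) => nth 0 xc.1 i)) => // k k9.
  apply: isvar_eq (isvar_news _ (Ordinal k9)) => c.
  by rewrite (tnth_nth 0).
- apply: (@def_eqv _ _ _ _ _ _ _ (fun D c => forall w : 9.-tuple R,
    holds (@tri_psat R sigma D) f (cons_tuple (dec9 (fun i => nth 0 w i)) (rho c)))).
    move=> D c; split=> [H t|H w]; last exact: H.
    by have := H [tuple tcoord t i | i < 9]; rewrite dec9_tuple.
  apply: def_alls; apply: IH => j.
  case: (unliftP ord0 j) => [j'|] -> i i9.
    apply: (@isvar_eq _ _ _ _ (fun xc => tcoord (tnth (rho xc.2) j') i)).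
      by move=> c; rewrite tnthS.
    exact: (@tvar_ctxs _ _ _ 9 _ (v j') i i9).
  apply: (@tvar_dec9 _ _ _ (fun i (xc : 9.-tuple R * C) => nth 0 xc.1 i)) => // k k9.
  apply: isvar_eq (isvar_news _ (Ordinal k9)) => c.
  by rewrite (tnth_nth 0).
Qed.

Lemma timeidx_lt k i : (i < 9 * k)%N -> (timeidx i < 9 * k)%N.
Proof. by rewrite /timeidx; case: ifP; lia. Qed.

Lemma def_cotemporal C N (e : C -> N.-tuple R) k (w : C -> (9 * k).-tuple R) :
  (forall i, isterm e (fun c => tnth (w c) i)) ->
  rdef e (fun _ c => coords (dec (w c)) = w c).
Proof.
move=> tw; apply: (@def_eqv _ _ _ _ _ _ _ (fun D c =>
  forall i : 'I_(9 * k), tnth (w c) (Ordinal (timeidx_lt (ltn_ord i))) = tnth (w c) i)).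
  move=> D c; split=> [H|<- i].
    apply: eq_from_tnth => i; rewrite (tnth_nth 0) nth_coords_dec //.
    by rewrite -H (tnth_nth 0).
  by rewrite !(tnth_nth 0) !nth_coords_dec //= ?nth_coords_dec ?timeidx_lt //;
    congr nth; rewrite /timeidx; do ! case: ifP; lia.
by apply: rdef_forall => i; apply: def_eq.
Qed.

Lemma tvar_dec C N (e : C -> N.-tuple R) k (w : C -> (9 * k).-tuple R) j :
  (forall i, isvar e (fun c => tnth (w c) i)) ->
  tvar e (fun c => tnth (dec (w c)) j).
Proof.
move=> vw i i9; have j3 := ltn_ord j.
have lt : (9 * j + timeidx i < 9 * k)%N by rewrite /timeidx; case: ifP; lia.
apply: isvar_eq (vw (Ordinal lt)) => c.
by rewrite tnth_mktuple tcoord_dec9 // (tnth_nth 0).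
Qed.

Lemma expressed_real_expressible k (Q : database R sigma -> option (strelation R k)) :
  FO_triangle_expressed Q -> FO_real_expressible Q.
Proof.
move=> [f Hf].
(* Since decoding is total, the first conjunct is what excludes vectors that are not coordinates of
   triangles. *)
have [||h Hh] := @def_and _ _ _ (@real_psat R sigma) _ _ id
  (fun D (v : (9 * k).-tuple R) => coords (dec v) = v)
  (fun D v => holds (@tri_psat R sigma D) f (dec v)).
- by apply: def_cotemporal => i; constructor; exists i.
- by apply: def_holds_tri => j; apply: tvar_dec => i; exists i.
exists h => D; have [S QS SE] := Hf D; exists S => //.
apply/seteqP; split=> v.
  by move=> /image_coords[e]; rewrite SE => H; apply/(Hh (of_db D)).
by move=> /(Hh (of_db D))[e H]; apply/image_coords; rewrite SE.
Qed.

Lemma expressed_generic k (Q : database R sigma -> option (strelation R k)) :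
  FO_triangle_expressed Q -> generic Q.
Proof.
move=> [f Hf] g D D' HD; have [S -> SE] := Hf D; have [S' -> SE'] := Hf D'.
have vg := valid_params_of g.
have actE m (T : m.-tuple (triangle R)) : map_tuple (act_triangle g) T = acts (params_of g) T.
  by apply: eq_from_tnth => i; rewrite !tnth_map act_params_of.
(* [pull] is a preimage, so D' = gD is turned around into D = g^-1 D'. *)
have DE : of_db D = pull (params_of g) (of_db D').
  apply: eq_pstruct => r T /=; rewrite HD; split=> [H|[T' H]].
    by exists T; rewrite ?actE.
  by rewrite actE => /(can_inj (actsK vg)) <-.
rewrite /= SE SE'; congr Some; apply/seteqP; split=> T /=.
  move=> H; exists (acts (ginv (params_of g)) T); last by rewrite actE actsVK.
  change (holds (@tri_psat R sigma (of_db D)) f (acts (ginv (params_of g)) T)).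
  by rewrite DE; apply/holds_pull => //; rewrite actsVK.
move=> [T' H <-]; rewrite actE.
have : holds (@tri_psat R sigma (of_db D)) f T' by [].
by rewrite DE => /holds_pull; apply.
Qed.

End Soundness.

(** * Open boxes and quantifier elimination *)

Section Boxes.
Variable R : realType.

Definition box n (c : n.-tuple R) (eps : R) (u : n.-tuple R) :=
  forall i, `|tnth u i - tnth c i| < eps.

Definition cont n (a : n.-tuple R -> R) := forall c eps, 0 < eps ->
  exists2 delta, 0 < delta & forall u, box c delta u -> `|a u - a c| < eps.

Lemma boxS n (c : n.-tuple R) d1 d2 u : d1 <= d2 -> box c d1 u -> box c d2 u.
Proof. by move=> d12 b i; apply: lt_le_trans (b i) d12. Qed.

Lemma box_in n (c u : n.-tuple R) eps : box c eps u ->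
  exists2 delta, 0 < delta & forall v, box u delta v -> box c eps v.
Proof.
move=> b.
(* The inverse of one plus the sum of the inverse slacks is below every slack; it replaces a finite
   minimum and is positive for n = 0 too. *)
pose s := \sum_i (eps - `|tnth u i - tnth c i|)^-1.
have s0 i : 0 < (eps - `|tnth u i - tnth c i|)^-1 by rewrite invr_gt0 subr_gt0.
have sle i : (eps - `|tnth u i - tnth c i|)^-1 <= s.
  by rewrite /s (bigD1 i) //= lerDl; apply: sumr_ge0 => j _; apply/ltW/s0.
have s1 : 0 < s + 1 by apply: ltr_wpDl ltr01; apply: sumr_ge0 => j _; apply/ltW/s0.
exists (s + 1)^-1; rewrite ?invr_gt0 // => v bv i.
have lt : (s + 1)^-1 <= eps - `|tnth u i - tnth c i|.
  rewrite -[leRHS]invrK lef_pV2 ?posrE //.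
  by apply: le_trans (sle i) _; rewrite lerDl ler01.
have := lt_le_trans (bv i) lt; rewrite ltrBrDr; apply: le_lt_trans.
by apply: le_trans (ler_normD _ _); rewrite addrA subrK.
Qed.

Lemma cont_ext n (a b : n.-tuple R -> R) : a =1 b -> cont a -> cont b.
Proof. by move=> ab; rewrite (functional_extensionality_dep ab). Qed.

Lemma cont_const n a : cont (fun _ : n.-tuple R => a).
Proof. by move=> c eps e0; exists 1 => // u _; rewrite subrr normr0. Qed.

Lemma cont_var n i : cont (fun u : n.-tuple R => tnth u i).
Proof. by move=> c eps e0; exists eps. Qed.

Lemma cont_opp n (a : n.-tuple R -> R) : cont a -> cont (fun u => - a u).
Proof.
move=> ca c eps /(ca c)[d d0 H]; exists d => // u /H.
by rewrite -opprD normrN.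
Qed.

Lemma cont_add n (a b : n.-tuple R -> R) : cont a -> cont b ->
  cont (fun u => a u + b u).
Proof.
move=> ca cb c eps e0; have e2 : 0 < eps / 2 by rewrite divr_gt0.
have [d1 d10 H1] := ca c _ e2; have [d2 d20 H2] := cb c _ e2.
exists (Num.min d1 d2); first by rewrite lt_min d10.
move=> u bu; rewrite (_ : _ - _ = (a u - a c) + (b u - b c)); last by ring.
apply: le_lt_trans (ler_normD _ _) _; rewrite [ltRHS]splitr.
by apply: ltrD; [apply: H1|apply: H2]; apply: boxS bu; rewrite ge_min lexx ?orbT.
Qed.

Lemma cont_mul n (a b : n.-tuple R -> R) : cont a -> cont b ->
  cont (fun u => a u * b u).
Proof.
move=> ca cb c eps e0.
pose A := `|a c| + 1; pose B := `|b c| + 1.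
have A0 : 0 < A by rewrite ltr_wpDl.
have B0 : 0 < B by rewrite ltr_wpDl.
have e1 : 0 < eps / 2 / B by rewrite !divr_gt0.
(* The bound 1 keeps |b u| below B; the other bound makes the second summand small. *)
have e2 : 0 < Num.min 1 (eps / 2 / A) by rewrite lt_min ltr01 !divr_gt0.
have [d1 d10 H1] := ca c _ e1; have [d2 d20 H2] := cb c _ e2.
exists (Num.min d1 d2); first by rewrite lt_min d10.
move=> u bu.
have h1 : `|a u - a c| < eps / 2 / B.
  by apply: H1; apply: boxS bu; rewrite ge_min lexx.
have : `|b u - b c| < Num.min 1 (eps / 2 / A).
  by apply: H2; apply: boxS bu; rewrite ge_min lexx orbT.
rewrite lt_min => /andP[h2 h3].
have hb : `|b u| <= B.
  rewrite -(subrK (b c) (b u)); apply: le_trans (ler_normD _ _) _.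
  by rewrite addrC lerD2l ltW.
rewrite (_ : _ - _ = (a u - a c) * b u + a c * (b u - b c)); last by ring.
apply: le_lt_trans (ler_normD _ _) _; rewrite !normrM [ltRHS]splitr.
apply: ltr_leD.
  apply: (@le_lt_trans _ _ (`|a u - a c| * B)); first exact: ler_wpM2l.
  by rewrite -ltr_pdivlMr.
apply: (@le_trans _ _ (A * `|b u - b c|)); first by rewrite ler_wpM2r // lerDl ler01.
by rewrite mulrC -ler_pdivlMr // ltW.
Qed.

Lemma cont_exp n (a : n.-tuple R -> R) m : cont a -> cont (fun u => a u ^+ m).
Proof.
move=> ca; elim: m => [|m IH]; first exact: cont_const.
by apply: cont_ext (cont_mul ca IH) => u; rewrite exprS.
Qed.

Lemma cont_natmul n (a : n.-tuple R -> R) m : cont a -> cont (fun u => a u *+ m).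
Proof.
move=> ca; apply: cont_ext (cont_mul ca (@cont_const n m%:R)) => u.
by rewrite mulr_natr.
Qed.

Lemma cont_box n m (F : n.-tuple R -> m.-tuple R) c eps :
  (forall i, cont (fun u => tnth (F u) i)) -> 0 < eps ->
  exists2 delta, 0 < delta & forall u, box c delta u -> box (F c) eps (F u).
Proof.
move=> cF e0.
have /boolp.choice[d Hd] : forall i, exists d, 0 < d /\
    forall u, box c d u -> `|tnth (F u) i - tnth (F c) i| < eps.
  by move=> i; have [d d0 H] := cF i c _ e0; exists d.
have d0 i : 0 < (d i)^-1 by rewrite invr_gt0; have [] := Hd i.
have s1 : 0 < \sum_i (d i)^-1 + 1.
  by apply: ltr_wpDl ltr01; apply: sumr_ge0 => j _; apply/ltW/d0.
exists (\sum_i (d i)^-1 + 1)^-1; rewrite ?invr_gt0 // => u bu i.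
have [di0 H] := Hd i; apply: H; apply: boxS bu.
rewrite -[leRHS]invrK lef_pV2 ?posrE // (bigD1 i) //= -addrA lerDl.
by apply: addr_ge0; rewrite ?ler01 //; apply: sumr_ge0 => j _; apply/ltW/d0.
Qed.

(** Either the function vanishes on the whole box, or it is nonzero at some point of it and, by
    continuity, keeps its sign nearby. *)
Lemma sign_box n (a : n.-tuple R -> R) c eps : cont a -> 0 < eps ->
  exists c' eps', [/\ 0 < eps', forall u, box c' eps' u -> box c eps u &
    (forall u, box c' eps' u -> a u = 0) \/ 
    (forall u, box c' eps' u -> 0 < a u) \/
    (forall u, box c' eps' u -> a u < 0)].
Proof.
move=> ca e0.
have [H|] := pselect (forall u, box c eps u -> a u = 0).
  by exists c, eps; split=> //; left.
move=> /existsNP[u /not_implyP[bu /eqP au]].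
have [d1 d10 H1] := box_in bu.
have au0 : 0 < `|a u| by rewrite normr_gt0.
have [d2 d20 H2] := ca u _ au0.
exists u, (Num.min d1 d2); split.
- by rewrite lt_min d10.
- by move=> v bv; apply: H1; apply: boxS bv; rewrite ge_min lexx.
have H v : box u (Num.min d1 d2) v -> `|a v - a u| < `|a u|.
  by move=> bv; apply: H2; apply: boxS bv; rewrite ge_min lexx orbT.
right; case: (ltrgtP 0 (a u)) au => // [pos|neg] _; [left|right] => v /H.
  by rewrite (gtr0_norm pos) ltr_norml => /andP[]; lra.
by rewrite (ltr0_norm neg) ltr_norml => /andP[_]; lra.
Qed.

Lemma cont_eval n (ev : n.-tuple R -> seq R) (t : GRing.term R) :
  (forall i, cont (fun u => nth 0 (ev u) i)) -> GRing.rterm t ->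
  cont (fun u => GRing.eval (ev u) t).
Proof.
move=> cev; elim: t => //=.
- by move=> x _; apply: cont_const.
- by move=> m _; apply: cont_const.
- by move=> t IH s IHs /andP[/IH ? /IHs ?]; apply: cont_add.
- by move=> t IH /IH ?; apply: cont_opp.
- by move=> t IH m /IH ?; apply: cont_natmul.
- by move=> t IH s IHs /andP[/IH ? /IHs ?]; apply: cont_mul.
- by move=> t IH m /IH ?; apply: cont_exp.
Qed.

(** The box is shrunk once for each atom, every new box being chosen inside the previous one; on the
    last box all atoms, hence q itself, have a constant truth value. *)
Lemma qf_const_box n (ev : n.-tuple R -> seq R) (q : ordered_qelim.ord.formula R) c eps :
  (forall i, cont (fun u => nth 0 (ev u) i)) ->
  ordered_qelim.ord.qf_form q && ordered_qelim.ord.rformula q -> 0 < eps ->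
  exists c' eps', [/\ 0 < eps', forall u, box c' eps' u -> box c eps u &
    exists b, forall u, box c' eps' u -> ordered_qelim.ord.qf_eval (ev u) q = b].
Proof.
move=> cev.
(* A constant sign of the difference decides equality and both kinds of inequality at once. *)
have atom t1 t2 c0 eps0 : GRing.rterm t1 && GRing.rterm t2 -> 0 < eps0 ->
    exists c' eps', [/\ 0 < eps', forall u, box c' eps' u -> box c0 eps0 u &
     exists b1 b2, forall u, box c' eps' u ->
      (GRing.eval (ev u) t1 == GRing.eval (ev u) t2) = b1 /\
      (GRing.eval (ev u) t1 < GRing.eval (ev u) t2) = b2].
  move=> /andP[r1 r2] e0.
  have ct := cont_add (cont_eval cev r2) (cont_opp (cont_eval cev r1)).
  have [c' [e' [e'0 sub H]]] := sign_box c0 ct e0.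
  exists c', e'; split=> //; case: H => [H|[H|H]].
  - exists true, false => u /H /eqP; rewrite subr_eq0 => /eqP ->.
    by rewrite eqxx ltxx.
  - exists false, true => u /H; rewrite subr_gt0 => lt.
    by rewrite lt (lt_eqF lt).
  - exists false, false => u /H; rewrite subr_lt0 => lt.
    by rewrite (gt_eqF lt) (lt_gtF lt).
have comb b (op : bool -> bool -> bool) q1 q2 :
  (forall c0 e0, 0 < e0 -> exists c' eps', [/\ 0 < eps', forall u, box c' eps' u -> box c0 e0 u &
    exists b, forall u, box c' eps' u -> ordered_qelim.ord.qf_eval (ev u) q1 = b]) ->
  (forall c0 e0, 0 < e0 -> exists c' eps', [/\ 0 < eps', forall u, box c' eps' u -> box c0 e0 u &
    exists b, forall u, box c' eps' u -> ordered_qelim.ord.qf_eval (ev u) q2 = b]) ->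
  (forall u, ordered_qelim.ord.qf_eval (ev u) b =
    op (ordered_qelim.ord.qf_eval (ev u) q1) (ordered_qelim.ord.qf_eval (ev u) q2)) ->
  forall c0 e0, 0 < e0 -> exists c' eps', [/\ 0 < eps', forall u, box c' eps' u -> box c0 e0 u &
    exists b0, forall u, box c' eps' u -> ordered_qelim.ord.qf_eval (ev u) b = b0].
  move=> H1 H2 Hop c0 e0 /(H1 c0)[c1 [e1 [e10 sub1 [b1 Hb1]]]].
  have [c2 [e2 [e20 sub2 [b2 Hb2]]]] := H2 c1 _ e10.
  exists c2, e2; split=> // [u /sub2/sub1//|].
  by exists (op b1 b2) => u bu; rewrite Hop Hb2 // Hb1 //; apply: sub2.
elim: q c eps => [b|t1 t2|t1 t2|t1 t2|t|q1 IH1 q2 IH2|q1 IH1 q2 IH2|q1 IH1 q2 IH2|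
   q IH|i q IH|i q IH] c eps //=.
- by move=> _ e0; exists c, eps; split=> //; exists b.
- move=> /atom H /(H c)[c' [e' [e'0 sub [b1 [b2 Hb]]]]].
  by exists c', e'; split=> //; exists b1 => u /Hb[].
- move=> /atom H /(H c)[c' [e' [e'0 sub [b1 [b2 Hb]]]]].
  by exists c', e'; split=> //; exists b2 => u /Hb[].
- move=> /atom H /(H c)[c' [e' [e'0 sub [b1 [b2 Hb]]]]].
  by exists c', e'; split=> //; exists (b1 || b2) => u /Hb[<- <-]; rewrite le_eqVlt.
- rewrite andbACA => /andP[w1 w2].
  apply: (comb (ordered_qelim.ord.And q1 q2) andb q1 q2) => // c0 e0.
    exact: IH1.
  exact: IH2.
- rewrite andbACA => /andP[w1 w2].
  apply: (comb (ordered_qelim.ord.Or q1 q2) orb q1 q2) => // c0 e0.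
    exact: IH1.
  exact: IH2.
- rewrite andbACA => /andP[w1 w2].
  apply: (comb (ordered_qelim.ord.Implies q1 q2) implb q1 q2) => // c0 e0.
    exact: IH1.
  exact: IH2.
- move=> w /(IH c _ w)[c' [e' [e'0 sub [b Hb]]]].
  by exists c', e'; split=> //; exists (~~ b) => u /Hb ->.
Qed.

Lemma rational_in_box n (c : n.-tuple R) eps : 0 < eps ->
  exists N (z : 'I_n -> int), box c eps [tuple (z i)%:~R / N.+1%:R | i < n].
Proof.
move=> e0; exists (Num.truncn eps^-1), (fun i => Num.floor ((Num.truncn eps^-1).+1%:R * tnth c i)) => i.
rewrite tnth_mktuple; set M := _.+1.
have M0 : 0 < M%:R :> R by rewrite ltr0n.
have lt : M%:R^-1 < eps.
  by rewrite -[ltRHS]invrK ltf_pV2 ?posrE ?invr_gt0 // truncnS_gt.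
apply: le_lt_trans lt.
rewrite [X in _ - X](_ : _ = M%:R * tnth c i / M%:R); last first.
  by rewrite mulrAC mulfV ?mul1r ?lt0r_neq0.
have /andP[h1 h2] := floor_itv (M%:R * tnth c i).
move: h2; rewrite intrD mulr1z => h2.
rewrite -mulrBl normrM [X in _ * X]gtr0_norm ?invr_gt0 //.
rewrite ler_piMl ?invr_ge0 ?ler0n // distrC ger0_norm ?subr_ge0 //.
by rewrite lerBlDr addrC ltW.
Qed.

End Boxes.

(** * Quantifier elimination for real formulas over a fixed database *)

Section QuantifierElimination.
Variables (R : realType) (sigma : schema).
Import ordered_qelim.

Fixpoint zpoly_term n (s : 'I_n -> nat) (p : zpoly n) : GRing.term R :=
  match p with
  | ZVar i => GRing.Var R (s i)
  | ZZero => GRing.NatConst R 0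
  | ZOne => GRing.NatConst R 1
  | ZOpp p1 => GRing.Opp (zpoly_term s p1)
  | ZAdd p1 p2 => GRing.Add (zpoly_term s p1) (zpoly_term s p2)
  | ZMul p1 p2 => GRing.Mul (zpoly_term s p1) (zpoly_term s p2)
  end.

Lemma rterm_zpoly n (s : 'I_n -> nat) p : GRing.rterm (zpoly_term s p).
Proof. by elim: p => //= p -> q ->. Qed.

Lemma eval_zpoly_term n (s : 'I_n -> nat) p e (v : n.-tuple R) :
  (forall i, e`_(s i) = tnth v i) -> GRing.eval e (zpoly_term s p) = zpoly_eval p v.
Proof. by move=> H; elim: p => //= [p ->|p -> q ->|p -> q ->]. Qed.

Fixpoint sa_formula n (s : 'I_n -> nat) (d : sa_desc n) : ord.formula R :=
  match d with
  | SPos p => ord.Lt (GRing.NatConst R 0) (zpoly_term s p)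
  | SNot d1 => ord.Not (sa_formula s d1)
  | SAnd d1 d2 => ord.And (sa_formula s d1) (sa_formula s d2)
  | SOr d1 d2 => ord.Or (sa_formula s d1) (sa_formula s d2)
  end.

Lemma rformula_sa n (s : 'I_n -> nat) d : ord.rformula (sa_formula s d).
Proof. by elim: d => //= [p|d -> d' ->|d -> d' ->] //; apply: rterm_zpoly. Qed.

Lemma holds_sa n (s : 'I_n -> nat) d e (v : n.-tuple R) :
  (forall i, e`_(s i) = tnth v i) -> ord.holds e (sa_formula s d) <-> sa_set d v.
Proof.
move=> H; elim: d => [p|d IH|d IH d' IH'|d IH d' IH'] /=.
- by rewrite (eval_zpoly_term _ H).
- by rewrite IH.
- by rewrite IH IH'.
- by rewrite IH IH'.
Qed.

Variables (D : pstruct R sigma) (d : forall r : relname sigma, sa_desc (9 * arity r)).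
Hypothesis dD : forall r, @coords R _ @` @ps_set _ _ D r = sa_set (d r).

(* De Bruijn indices become levels: evaluation takes place in the reversed
   environment, to whose end a quantifier adds its variable. *)
Fixpoint qe_formula n (f : formula (real_atom sigma) n) : ord.formula R :=
  match f with
  | Atom (RPos p) => ord.Lt (GRing.NatConst R 0) (zpoly_term (fun i : 'I_n => (n - i.+1)%N) p)
  | Atom (RRel r w) => sa_formula (fun i => (n - (tnth w i).+1)%N) (d r)
  | Not f1 => ord.Not (qe_formula f1)
  | And f1 f2 => ord.And (qe_formula f1) (qe_formula f2)
  | Or f1 f2 => ord.Or (qe_formula f1) (qe_formula f2)
  | Ex f1 => ord.Exists n (qe_formula f1)
  | All f1 => ord.Forall n (qe_formula f1)
  end.

Lemma rformula_qe n (f : formula (real_atom sigma) n) : ord.rformula (qe_formula f).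
Proof.
elim: n / f => //= [n [p|r w]|n f -> h ->|n f -> h ->] //; first exact: rterm_zpoly.
exact: rformula_sa.
Qed.

Lemma holds_qe n (f : formula (real_atom sigma) n) (v : n.-tuple R) :
  ord.holds (rev v) (qe_formula f) <-> holds (@real_psat R sigma D) f v.
Proof.
have nthr m (w : m.-tuple R) (i : 'I_m) : (rev w)`_(m - i.+1) = tnth w i.
  rewrite nth_rev size_tuple ?(tnth_nth 0); last by have := ltn_ord i; lia.
  by congr nth; have := ltn_ord i; lia.
have ext m (w : m.-tuple R) x : set_nth 0 (rev w) m x = rev (cons_tuple x w).
  rewrite /= rev_cons -[X in set_nth _ _ X](size_tuple w) -size_rev.
  by elim: (rev w) => //= y s ->.
elim: n / f v => [n [p|r w]|n f IH|n f IHf h IHh|n f IHf h IHh|n f IH|n f IH] v.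
- by rewrite /= (eval_zpoly_term _ (nthr _ v)).
- rewrite [X in _ <-> X](_ : _ = sa_set (d r) (map_tuple (tnth v) w)).
    by apply: holds_sa => i; rewrite nthr tnth_map.
  by rewrite -dD.
- by rewrite /= IH.
- by rewrite /= IHf IHh.
- by rewrite /= IHf IHh.
- split=> -[x Hx]; exists x.
    by move: Hx; rewrite ext => /(IH (cons_tuple x v)).
  by rewrite ext; apply/(IH (cons_tuple x v)).
- split=> H x.
    by have := H x; rewrite ext => /(IH (cons_tuple x v)).
  by rewrite ext; apply/(IH (cons_tuple x v)).
Qed.

(** Once the relation names are replaced by semi-algebraic descriptions, f is a formula of ordered
    fields without inverses, and elimination for real closed fields applies. *)
Lemma real_quantifier_elimination n (f : formula (real_atom sigma) n) :
  exists2 q : ord.formula R, ord.qf_form q && ord.rformula q &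
  forall v : n.-tuple R,
    ord.qf_eval (rev v) q <-> holds (@real_psat R sigma D) f v.
Proof.
exists (ord.quantifier_elim
  (fun i bc => qe_rcf.qfr_to_formula (@qe_rcf.wproj R i bc)) (qe_formula f)).
  by apply: ord.quantifier_elim_wf (rformula_qe f); exact: qe_rcf.wf_QE_wproj.
move=> v; rewrite -holds_qe; apply: iff_sym; apply: rwP.
apply: ord.quantifier_elim_rformP (rformula_qe f).
  exact: qe_rcf.wf_QE_wproj.
exact: qe_rcf.valid_QE_wproj.
Qed.

End QuantifierElimination.

(** * Making a generic real formula invariant under all real affinities *)

Section OpenHolds.
Variables (R : realType) (sigma : schema) (k : nat).
Variable f : formula (real_atom sigma) (9 * k).
Implicit Types (D : pstruct R sigma) (T : k.-tuple (triangle R)) (g h : 10.-tuple R).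

(* For valid [g]: T belongs to the image under g of what f defines on g^-1 D. *)
Definition moved_holds D g T := valid g /\
  exists T', acts g T' = T /\ holds (@real_psat R sigma (pull g D)) f (coords T').

(** The center of the box is left free, so that a left translation may move it. *)
Definition open_holds D T := exists c eps, 0 < eps /\
  forall g, box c eps g -> moved_holds D g T.

(** Both sides evaluate f on the pull of D by hg. Hence the set of suitable g for h^-1 D and T is
    the left translate by h^-1 of the set for D and hT. *)
Lemma moved_holds_pull h D g T : valid h ->
  moved_holds (pull h D) g T <-> moved_holds D (gmul h g) (acts h T).
Proof.
move=> vh; split=> -[vg [T' [e H]]].
  split; first exact: valid_mul.
  by exists T'; rewrite acts_mul e -pull_mul.
split.
  by have := valid_mul (valid_inv vh) vg; rewrite gmulA gmulVg // gmul1.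
exists T'; rewrite pull_mul; split=> //.
by apply: (can_inj (actsK vh)); rewrite -acts_mul.
Qed.

Lemma cont_gmul h i : cont (fun g => tnth (gmul h g) i).
Proof.
have cv j : (j < 10)%N -> cont (fun g => g`_j).
  by move=> lt; apply: cont_ext (cont_var (Ordinal lt)) => g; rewrite (tnth_nth 0).
have H j : (j < 10)%N -> cont (fun g => (gmul h g)`_j).
  by do 10 (case: j => [_|j]; first by rewrite /=;
    repeat first [apply: cont_add | apply: cont_mul | apply: cont_const | apply: cv]).
by apply: cont_ext (H i (ltn_ord i)) => g; rewrite (tnth_nth 0).
Qed.

Lemma open_holds_pull h D T : valid h ->
  open_holds (pull h D) T <-> open_holds D (acts h T).
Proof.
suff H h' D' T' : valid h' -> open_holds (pull h' D') T' -> open_holds D' (acts h' T').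
  move=> vh; split; first exact: H.
  rewrite -{1}(pull_one D) -(gmulgV vh) -pull_mul => /(H _ _ _ (valid_inv vh)).
  by rewrite actsK.
move=> vh [c [eps [e0 Hc]]].
(* Continuity of left translation by the inverse at h'c yields a box around h'c that is mapped into
   the given box around c. *)
have [|d d0 Hd] := @cont_box _ _ _ (gmul (ginv h')) (gmul h' c) eps _ e0.
  by move=> i; apply: cont_gmul.
exists (gmul h' c), d; split=> // g /Hd.
rewrite gmulA gmulVg // gmul1 => /Hc /moved_holds_pull -/(_ vh).
by rewrite gmulA gmulgV // gmul1.
Qed.

Section Definability.
Notation rdef := (@definable (real_atom sigma) R (pstruct R sigma) (@real_psat R sigma)).
Variables (C : Type) (N : nat) (e : C -> N.-tuple R).

Lemma term_zpoly n (p : zpoly n) (w : C -> n.-tuple R) :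
  (forall i, isterm e (fun c => tnth (w c) i)) ->
  isterm e (fun c => zpoly_eval p (w c)).
Proof.
move=> tw; elim: p => /= [i|||p IH|p IH q IHq|p IH q IHq] //.
- exact: term0.
- exact: term1.
- exact: termN.
- exact: termD.
- exact: termM.
Qed.

Lemma term_params (g : C -> 10.-tuple R) j : (j < 10)%N ->
  (forall i, isvar e (fun c => tnth (g c) i)) -> isterm e (fun c => (g c)`_j).
Proof.
move=> lt vg; constructor; apply: isvar_eq (vg (Ordinal lt)) => c.
by rewrite (tnth_nth 0).
Qed.

Lemma term_act (g : C -> 10.-tuple R) (t : C -> triangle R) i : (i < 9)%N ->
  (forall i, isvar e (fun c => tnth (g c) i)) -> tvar e t ->
  isterm e (fun c => tcoord (act (g c) (t c)) i).
Proof.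
move=> i9 vg vt; rewrite /tcoord; set j := inord _.
have [tx ty tt] := tvar_cor j vt.
have tg m lt := @term_params g m lt vg.
have tt' : isterm e (fun c => (cor (t c) j).2).
  by apply: term_eq tt => c; rewrite cor_time.
have : (i %% 3 < 3)%N by rewrite ltn_mod.
case: (i %% 3)%N => [|[|[|//]]] _ /=.
- apply: (@term_eq _ _ _ _ (fun c => px (act_pt (g c) (cor (t c) j)))).
    by move=> c; rewrite cor_act.
  apply: (@term_eq _ _ _ _ (fun c => (g c)`_0 * px (cor (t c) j) +
     (g c)`_1 * py (cor (t c) j) + (g c)`_4 + (cor (t c) j).2 * (g c)`_6)).
    by move=> c; rewrite px_mkpt.
  by do ! [apply: termD | apply: termM | apply: tg | ].
- apply: (@term_eq _ _ _ _ (fun c => py (act_pt (g c) (cor (t c) j)))).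
    by move=> c; rewrite cor_act.
  apply: (@term_eq _ _ _ _ (fun c => (g c)`_2 * px (cor (t c) j) +
     (g c)`_3 * py (cor (t c) j) + (g c)`_5 + (cor (t c) j).2 * (g c)`_7)).
    by move=> c; rewrite py_mkpt.
  by do ! [apply: termD | apply: termM | apply: tg | ].
- apply: (@term_eq _ _ _ _ (fun c => (g c)`_8 * (cor (t c) j).2 + (g c)`_9)).
    by move=> c; rewrite cor_act.
  by do ! [apply: termD | apply: termM | apply: tg | ].
Qed.

Lemma term_coords_act m (g : C -> 10.-tuple R) (w : C -> (9 * m).-tuple R) i :
  (forall i, isvar e (fun c => tnth (g c) i)) ->
  (forall i, isvar e (fun c => tnth (w c) i)) ->
  isterm e (fun c => tnth (coords (acts (g c) (dec (w c)))) i).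
Proof.
move=> vg vw; have lt : (i %/ 9 < m)%N by have := ltn_ord i; lia.
apply: (@term_eq _ _ _ _ (fun c => tcoord (act (g c) (tnth (dec (w c)) (Ordinal lt))) (i %% 9))).
  by move=> c; rewrite [RHS](tnth_nth 0) (coordsE _ lt) [in RHS]tnth_map.
by apply: term_act; rewrite ?ltn_mod //; apply: tvar_dec.
Qed.

Lemma isvar_coords_dec m (w : C -> (9 * m).-tuple R) i :
  (forall i, isvar e (fun c => tnth (w c) i)) ->
  isvar e (fun c => tnth (coords (dec (w c))) i).
Proof.
move=> vw; apply: isvar_eq (vw (Ordinal (timeidx_lt (ltn_ord i)))) => c.
by rewrite !(tnth_nth 0) nth_coords_dec.
Qed.

End Definability.

Notation rdef := (@definable (real_atom sigma) R (pstruct R sigma) (@real_psat R sigma)).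

Lemma isvar_tnth_cons C N (e : C -> N.-tuple R) n (rho : C -> n.-tuple R) :
  (forall i, isvar e (fun c => tnth (rho c) i)) ->
  forall i, isvar (ctx1 e) (fun xc => tnth (cons_tuple xc.1 (rho xc.2)) i).
Proof.
move=> vr i; case: (unliftP ord0 i) => [j|] ->.
  by apply: isvar_eq (isvar_ctx1 (vr j)) => c; rewrite tnthS.
exact: isvar_eq (isvar_new e).
Qed.

(** Real quantifiers are unaffected by g; only relation atoms change. Membership in a moved relation
    is membership of the moved tuple in the original one, and its coordinates are polynomial in g
    and the old coordinates. *)
Lemma def_holds_pull n (h : formula (real_atom sigma) n) C N (e : C -> N.-tuple R)
    (g : C -> 10.-tuple R) (rho : C -> n.-tuple R) :
  (forall i, isvar e (fun c => tnth (g c) i)) ->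
  (forall i, isvar e (fun c => tnth (rho c) i)) ->
  rdef e (fun D c => holds (@real_psat R sigma (pull (g c) D)) h (rho c)).
Proof.
elim: n / h C N e g rho => [n [p|r i]|n h IH|n h IHh l IHl|n h IHh l IHl|n h IH|n h IH]
  C N e g rho vg vr /=.
- by apply: def_pos; apply: term_zpoly => i; constructor.
- pose w c := map_tuple (tnth (rho c)) i.
  have vw j : isvar e (fun c => tnth (w c) j).
    by apply: isvar_eq (vr (tnth i j)) => c; rewrite tnth_map.
  apply: (@def_eqv _ _ _ _ _ _ _ (fun D c => coords (dec (w c)) = w c /\
     (@coords R _ @` @ps_set _ _ D r) (coords (acts (g c) (dec (w c)))))).
    by move=> D c; rewrite image_coordsE [X in _ <-> X]image_coords.
  apply: def_and; first by apply: def_cotemporal => j; constructor.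
  by apply: def_rel => j; apply: term_coords_act.
- by apply: def_not; apply: IH.
- by apply: def_and; [apply: IHh|apply: IHl].
- by apply: def_or; [apply: IHh|apply: IHl].
- apply: def_ex; apply: (IH _ _ _ (fun xc => g xc.2)).
    by move=> i; apply: (isvar_ctx1 (vg i)).
  exact: isvar_tnth_cons.
- apply: def_all; apply: (IH _ _ _ (fun xc => g xc.2)).
    by move=> i; apply: (isvar_ctx1 (vg i)).
  exact: isvar_tnth_cons.
Qed.

Lemma def_moved_holds C N (e : C -> N.-tuple R) (g : C -> 10.-tuple R)
    (w : C -> (9 * k).-tuple R) :
  (forall i, isvar e (fun c => tnth (g c) i)) ->
  (forall i, isvar e (fun c => tnth (w c) i)) ->
  rdef e (fun D c => moved_holds D (g c) (dec (w c))).
Proof.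
move=> vg vw; apply: def_and.
  apply: def_and.
    by apply: def_pos; apply: term_params.
  apply: (@def_eqv _ _ _ _ _ _ _ (fun D c =>
    ~ ((g c)`_0 * (g c)`_3 - (g c)`_1 * (g c)`_2 = 0))).
    by move=> D c; split=> /eqP.
  apply: def_not; apply: def_eq; last exact: term0.
  by apply: termB; apply: termM; apply: term_params.
apply: (@def_eqv _ _ _ _ _ _ _ (fun D c => exists v : (9 * k).-tuple R,
   (forall i, tnth (coords (acts (g c) (dec v))) i = tnth (coords (dec (w c))) i) /\
   holds (@real_psat R sigma (pull (g c) D)) f (coords (dec v)))).
  move=> D c; split=> -[v [e1 H]].
    by exists (dec v); split=> //; apply: coords_inj; apply: eq_from_tnth.
  by exists (coords v); rewrite decK e1.
have vg' := fun i => isvar_ctxs (9 * k) (vg i).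
have vw' := fun i => isvar_ctxs (9 * k) (vw i).
have vn := isvar_news (m := 9 * k) e.
apply: def_exs; apply: def_and.
  apply: rdef_forall => i; apply: def_eq; first exact: term_coords_act.
  by constructor; apply: (isvar_coords_dec (w := fun xc => w xc.2)).
apply: (def_holds_pull f (g := fun xc => g xc.2)) => // i.
exact: isvar_coords_dec.
Qed.

Lemma open_holds_definable : exists h : formula (real_atom sigma) (9 * k),
  forall D T, holds (@real_psat R sigma D) h (coords T) <-> open_holds D T.
Proof.
suff [h Hh] : rdef id (fun D (v : (9 * k).-tuple R) => open_holds D (dec v)).
  by exists h => D T; rewrite (Hh D (coords T)) decK.
apply: (@def_eqv _ _ _ _ _ _ _ (fun D (v : (9 * k).-tuple R) =>
  exists c : 10.-tuple R, exists eps : R, 0 < eps /\ forall g : 10.-tuple R,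
   ((forall i, tnth g i - tnth c i < eps /\ tnth c i - tnth g i < eps) ->
     moved_holds D g (dec v)))).
  have boxE (c g : 10.-tuple R) eps : box c eps g <->
      (forall i, tnth g i - tnth c i < eps /\ tnth c i - tnth g i < eps).
    split=> [b i|b i]; last by rewrite ltr_norml ltrNl opprB; apply/andP; have [] := b i.
    by have := b i; rewrite ltr_norml ltrNl opprB => /andP[].
  move=> D v; split=> -[c [eps [e0 H]]]; exists c, eps; split=> // g b; apply: H;
    exact/boxE.
have vid i : isvar id (fun v : (9 * k).-tuple R => tnth v i) by exists i.
apply: def_exs; apply: def_ex; apply: def_and.
  by apply: def_pos; constructor; apply: isvar_new.
apply: def_alls; apply: def_imp; last first.
  apply: def_moved_holds => i; first exact: isvar_news.
  exact: (isvar_ctxs _ (isvar_ctx1 (isvar_ctxs _ (vid i)))).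
have tc i := isvar_ctxs 10 (isvar_ctx1 (isvar_news (m := 10) (@id ((9 * k).-tuple R)) i)).
have te := isvar_ctxs 10 (isvar_new (ctxs (m := 10) (@id ((9 * k).-tuple R)))).
apply: rdef_forall => i; apply: def_and; apply: def_lt.
- by apply: termB; constructor; [apply: isvar_news|apply: tc].
- by constructor; apply: te.
- by apply: termB; constructor; [apply: tc|apply: isvar_news].
- by constructor; apply: te.
Qed.

End OpenHolds.

(** * Databases moved by rational affinities *)

Section RationalPull.
Variables (R : realType).

(** An integer polynomial up to a positive denominator, which affects neither its sign nor its
    zeros. *)
Definition qterm m (a : m.-tuple R -> R) :=
  exists N (p : zpoly m), forall v, zpoly_eval p v = N.+1%:R * a v.

Definition sadef m (P : m.-tuple R -> Prop) :=
  exists d : sa_desc m, forall v, sa_set d v <-> P v.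

Section Closure.
Variable m : nat.
Implicit Types a b : m.-tuple R -> R.

Fixpoint znat n : zpoly m := if n is n'.+1 then ZAdd ZOne (znat n') else ZZero.

Lemma eval_znat n v : zpoly_eval (znat n) v = n%:R :> R.
Proof. by elim: n => //= n ->; rewrite -natr1 addrC. Qed.

Lemma qterm_var i : qterm (fun v : m.-tuple R => tnth v i).
Proof. by exists 0%N, (ZVar i) => v; rewrite mul1r. Qed.

Lemma qterm0 : qterm (fun _ : m.-tuple R => 0).
Proof. by exists 0%N, ZZero => v; rewrite mulr0. Qed.

Lemma qterm_opp a : qterm a -> qterm (fun v => - a v).
Proof. by move=> [N [p Hp]]; exists N, (ZOpp p) => v /=; rewrite Hp mulrN. Qed.

Lemma qterm_denom a n (p : zpoly m) : (0 < n)%N ->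
  (forall v, zpoly_eval p v = n%:R * a v) -> qterm a.
Proof. by case: n => // n _ Hp; exists n, p. Qed.

Lemma qterm_add a b : qterm a -> qterm b -> qterm (fun v => a v + b v).
Proof.
move=> [N [p Hp]] [M [q Hq]].
apply: (@qterm_denom _ (N.+1 * M.+1)
  (ZAdd (ZMul (znat M.+1) p) (ZMul (znat N.+1) q))) => // v.
rewrite -[LHS]/(zpoly_eval (znat M.+1) v * zpoly_eval p v +
  zpoly_eval (znat N.+1) v * zpoly_eval q v).
by rewrite !eval_znat Hp Hq natrM; ring.
Qed.

Lemma qterm_mul a b : qterm a -> qterm b -> qterm (fun v => a v * b v).
Proof.
move=> [N [p Hp]] [M [q Hq]].
apply: (@qterm_denom _ (N.+1 * M.+1) (ZMul p q)) => // v.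
by rewrite [LHS]/= Hp Hq natrM; ring.
Qed.

Lemma qterm_rat (z : int) N : qterm (fun _ : m.-tuple R => z%:~R / N.+1%:R).
Proof.
exists N; case: z => n; [exists (znat n)|exists (ZOpp (znat n.+1))] => v /=;
  rewrite !eval_znat mulrCA mulfV ?mulr1 ?pnatr_eq0 //.
by rewrite NegzE mulrNz -pmulrn -natr1 addrC.
Qed.

Lemma qterm_eq a b : (forall v, a v = b v) -> qterm a -> qterm b.
Proof. by move=> ab [N [p Hp]]; exists N, p => v; rewrite -ab. Qed.

Lemma qterm_zpoly n (p : zpoly n) (w : m.-tuple R -> n.-tuple R) :
  (forall i, qterm (fun v => tnth (w v) i)) -> qterm (fun v => zpoly_eval p (w v)).
Proof.
move=> tw; elim: p => /= [i|||p IH|p IH q IHq|p IH q IHq] //.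
- exact: qterm0.
- by exists 0%N, ZOne => v; rewrite mul1r.
- exact: qterm_opp.
- exact: qterm_add.
- exact: qterm_mul.
Qed.

Lemma sadef_eqv P Q : (forall v : m.-tuple R, P v <-> Q v) -> sadef P -> sadef Q.
Proof. by move=> PQ [d Hd]; exists d => v; rewrite Hd. Qed.

Lemma sadef_pos a : qterm a -> sadef (fun v => 0 < a v).
Proof.
move=> [N [p Hp]]; exists (SPos p) => v /=.
by rewrite Hp pmulr_rgt0 // ltr0n.
Qed.

Lemma sadef_not P : @sadef m P -> sadef (fun v => ~ P v).
Proof. by move=> [d Hd]; exists (SNot d) => v /=; rewrite Hd. Qed.

Lemma sadef_and P Q : @sadef m P -> sadef Q -> sadef (fun v => P v /\ Q v).
Proof. by move=> [d Hd] [h Hh]; exists (SAnd d h) => v /=; rewrite Hd Hh. Qed.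

Lemma sadef_or P Q : @sadef m P -> sadef Q -> sadef (fun v => P v \/ Q v).
Proof. by move=> [d Hd] [h Hh]; exists (SOr d h) => v /=; rewrite Hd Hh. Qed.

Lemma sadef_eq a b : qterm a -> qterm b -> sadef (fun v => a v = b v).
Proof.
move=> ta tb.
have sub a' b' : qterm a' -> qterm b' -> sadef (fun v => ~ (0 < a' v - b' v)).
  by move=> ta' tb'; apply: sadef_not; apply: sadef_pos; apply: qterm_add => //;
    apply: qterm_opp.
apply: (sadef_eqv _ (sadef_and (sub _ _ ta tb) (sub _ _ tb ta))) => v.
rewrite !subr_gt0; split=> [[/negP]|->]; last by rewrite ltxx.
by rewrite -leNgt => ab /negP; rewrite -leNgt => ba; apply/eqP; rewrite eq_le ab.
Qed.

Lemma sadef_forall n (P : 'I_n -> m.-tuple R -> Prop) :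
  (forall i, sadef (P i)) -> sadef (fun v => forall i, P i v).
Proof.
move=> dP; suff [d Hd] : sadef (fun v => forall i, i \in enum 'I_n -> P i v).
  by exists d => v; rewrite Hd; split=> [H i|H i _] //; apply: H; rewrite mem_enum.
elim: (enum _) => [|i s IH].
  by exists (SNot (SPos ZZero)) => v; split=> //= _; rewrite ltxx.
apply: (sadef_eqv _ (sadef_and (dP i) IH)) => v; split=> [[Hi H] j|H].
  by rewrite inE => /predU1P[->|/H].
by split=> [|j js]; apply: H; rewrite inE ?eqxx ?js ?orbT.
Qed.

Lemma sadef_comp n (d : sa_desc n) (w : m.-tuple R -> n.-tuple R) :
  (forall i, qterm (fun v => tnth (w v) i)) -> sadef (fun v => sa_set d (w v)).
Proof.
move=> tw; elim: d => /= [p|d IH|d IH h IHh|d IH h IHh].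
- by apply: sadef_pos; apply: qterm_zpoly.
- exact: sadef_not.
- exact: sadef_and.
- exact: sadef_or.
Qed.

End Closure.

Definition ratparams (z : 'I_10 -> int) N : 10.-tuple R :=
  [tuple (z i)%:~R / N.+1%:R | i < 10].

Lemma qterm_coords_act z N m (i : 'I_(9 * m)) :
  qterm (fun v : (9 * m).-tuple R => tnth (coords (acts (ratparams z N) (dec v))) i).
Proof.
(* The coordinates are first treated as integer polynomials with the ten parameters as additional
   variables, for which rational values are then substituted. *)
pose e (v : (9 * m).-tuple R) := cat_tuple (ratparams z N) v.
have [||p Hp] := @termP R _ _ e _ (@term_coords_act R _ _ e m
  (fun=> ratparams z N) id i _ _).
- move=> j; exists (lshift (9 * m) j) => v; by rewrite tnth_lshift.
- by move=> j; exists (rshift 10 j) => v; rewrite tnth_rshift.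
apply: (qterm_eq Hp); apply: qterm_zpoly => j.
case: (split_ordP j) => j' ->.
  apply: (@qterm_eq _ (fun _ => (z j')%:~R / N.+1%:R)); last exact: qterm_rat.
  by move=> v; rewrite tnth_lshift tnth_mktuple.
apply: (@qterm_eq _ (fun v => tnth v j')); last exact: qterm_var.
by move=> v; rewrite tnth_rshift.
Qed.

(** The preimage of a semi-algebraic set under a polynomial map with rational coefficients is
    semi-algebraic over the integers, denominators being cleared. *)
Lemma pull_rational sigma (D : database R sigma) z N :
  exists D' : database R sigma, of_db D' = pull (ratparams z N) (of_db D).
Proof.
suff sa r : semialgebraic (@coords R _ @` @ps_set _ _ (pull (ratparams z N) (of_db D)) r).
  exists (fun r => STRelation (sa r) (@ps_perm _ _ (pull (ratparams z N) (of_db D)) r)).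
  exact: eq_pstruct.
have [d dE] := strel_semialgebraic (D r).
suff [h Hh] : sadef (fun v : (9 * arity r).-tuple R =>
   (forall i, tnth v (Ordinal (timeidx_lt (ltn_ord i))) = tnth v i) /\
   sa_set d (coords (acts (ratparams z N) (dec v)))).
  exists h; apply/seteqP; split=> v; rewrite image_coords Hh -dE image_coordsE.
    move=> [e H]; split=> // i.
    by rewrite -[in RHS]e [RHS](tnth_nth 0) nth_coords_dec // (tnth_nth 0).
  move=> [e H]; split=> //; apply: eq_from_tnth => i.
  by rewrite (tnth_nth 0) nth_coords_dec // -e (tnth_nth 0).
apply: sadef_and.
  by apply: sadef_forall => i; apply: sadef_eq; apply: qterm_var.
by apply: sadef_comp => i; apply: qterm_coords_act.
Qed.

End RationalPull.

(** * Agreement of the invariant formula with the query on databases *)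

Section Agreement.
Variables (R : realType) (sigma : schema) (k : nat).
Variable Q : database R sigma -> option (strelation R k).
Hypothesis genQ : generic Q.
Variable f : formula (real_atom sigma) (9 * k).
Hypothesis Hf : forall D, exists2 S, Q D = Some S
  & @coords R k @` S = [set v | holds (@real_sat R sigma D) f v].

(** Genericity is applied to the inverse of g, which maps D to D': what f defines on D' is g^-1 S,
    and moving it by g gives back S. *)
Lemma moved_holds_database (D D' : database R sigma) S g T : Q D = Some S ->
  valid g -> of_db D' = pull g (of_db D) -> moved_holds f (of_db D) g T <-> strel_set S T.
Proof.
move=> QD vg DD'.
have [h Hh] := params_of_surj (valid_inv vg).
have actE m (T0 : m.-tuple (triangle R)) : map_tuple (act_triangle h) T0 = acts (ginv g) T0.
  by apply: eq_from_tnth => i; rewrite !tnth_map -act_params_of Hh.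
have HD r : D' r = act_set h (D r) :> set _.
  have -> : strel_set (D' r) = @ps_set _ _ (of_db D') r by [].
  rewrite DD'; apply/seteqP; split=> U /=.
    by move=> DU; exists (acts g U) => //; rewrite actE actsK.
  by move=> [U' DU' <-]; rewrite actE actsVK.
have := genQ HD; have [S' -> SE] := Hf D'; rewrite QD /= => -[S'E].
have holdsE T' : holds (@real_psat R sigma (pull g (of_db D))) f (coords T') <-> strel_set S' T'.
  by rewrite -DD' -(image_coordsE (strel_set S')) SE.
split=> [[_ [T' [<-]]]|ST].
  by move/holdsE; rewrite S'E => -[U SU <-]; rewrite actE actsVK.
split=> //; exists (acts (ginv g) T); rewrite actsVK //; split=> //.
by apply/holdsE; rewrite S'E; exists T; rewrite ?actE.
Qed.

(** Within distance 1/4 of the identity both diagonal entries exceed 1/2, while the product of the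
    other two entries of M is at most 1/16; so the determinant is positive. *)
Lemma valid_near_one g : box (gone R) 4^-1 g -> valid g.
Proof.
move=> b; have H i : (i < 10)%N -> `|g`_i - (gone R)`_i| < 4^-1.
  by move=> lt; have := b (Ordinal lt); rewrite !(tnth_nth 0).
have := H 0%N isT; have := H 1%N isT; have := H 2%N isT; have := H 3%N isT.
have := H 8%N isT; rewrite /= !subr0 !ltr_norml.
move=> /andP[a8 _] /andP[a3 _] /andP[a2 b2] /andP[a1 b1] /andP[a0 _].
split; first by lra.
apply: lt0r_neq0; rewrite subr_gt0.
apply: (@le_lt_trans _ _ (4^-1 * 4^-1)).
  apply: le_trans (ler_norm _) _; rewrite normrM.
  by apply: ler_pM; rewrite ?normr_ge0 // ler_norml; apply/andP; split; apply/ltW.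
apply: (@lt_trans _ _ (2^-1 * 2^-1)); first by rewrite -!invfM ltf_pV2 ?posrE -?natrM ?ltr_nat ?ltr0n.
by apply: ltr_pM; rewrite ?invr_ge0 ?ler0n //; lra.
Qed.

Lemma open_holds_database (D : database R sigma) S T : Q D = Some S ->
  open_holds f (of_db D) T <-> strel_set S T.
Proof.
move=> QD.
have rat c eps : 0 < eps -> exists g D',
    box c eps g /\ of_db D' = pull g (of_db D).
  move=> /(rational_in_box c)[N [z bz]]; have [D' DD'] := pull_rational D z N.
  by exists (ratparams R z N), D'.
split=> [[c [eps [e0 H]]]|ST].
  have [g [D' [bg DD']]] := rat c eps e0; have Hg := H g bg.
  by apply/(moved_holds_database _ QD _ DD'); case: (Hg).
have sa r : exists d : sa_desc (9 * arity r),
    @coords R _ @` @ps_set _ _ (of_db D) r = sa_set d.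
  exact: strel_semialgebraic.
have dE r := projT2 (cid (sa r)).
have [||h Hh] := @def_moved_holds R sigma k f _ _ (fun v : (10 + 9 * k).-tuple R => v)
  (fun v => [tuple tnth v (lshift (9 * k) i) | i < 10])
  (fun v => [tuple tnth v (rshift 10 i) | i < 9 * k]).
- by move=> i; exists (lshift _ i) => v; rewrite tnth_mktuple.
- by move=> i; exists (rshift _ i) => v; rewrite tnth_mktuple.
have [q wq Hq] := real_quantifier_elimination dE h.
(* T is fixed and enters as a list of real constants, so that the atoms of q are continuous
   functions of g alone. *)
pose ev (g : 10.-tuple R) := rev (cat_tuple g (coords T)).
have evE g : ordered_qelim.ord.qf_eval (ev g) q <-> moved_holds f (of_db D) g T.
  rewrite /ev Hq (Hh (of_db D) (cat_tuple g (coords T))).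
  rewrite (_ : mktuple _ = g); last first.
    by apply: eq_from_tnth => i; rewrite tnth_mktuple tnth_lshift.
  rewrite (_ : mktuple _ = coords T) ?decK //.
  by apply: eq_from_tnth => i; rewrite tnth_mktuple tnth_rshift.
have cev i : cont (fun g => nth 0 (ev g) i).
  have sz (g : 10.-tuple R) : size (cat_tuple g (coords T)) = (10 + 9 * k)%N.
    by rewrite size_tuple.
  have [lt|ge] := ltnP i (10 + 9 * k); last first.
    apply: cont_ext (@cont_const R 10 0) => g.
    by rewrite nth_default // size_rev sz.
  have lt' : (10 + 9 * k - i.+1 < 10 + 9 * k)%N by lia.
  have E g : nth 0 (ev g) i = tnth (cat_tuple g (coords T)) (Ordinal lt').
    by rewrite /ev nth_rev ?sz // (tnth_nth 0).
  apply: cont_ext (fun g => esym (E g)) _.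
  case: (split_ordP (Ordinal lt')) => j ->.
    by apply: cont_ext (cont_var j) => g; rewrite tnth_lshift.
  by apply: cont_ext (@cont_const R 10 (tnth (coords T) j)) => g; rewrite tnth_rshift.
have e4 : 0 < 4^-1 :> R by rewrite invr_gt0 ltr0n.
(* Starting near the identity ensures that all parameters met are valid; on the subbox the truth
   value has the constant value b. *)
have [c [eps [e0 sub [b Hb]]]] := qf_const_box (gone R) cev wq e4.
exists c, eps; split=> // g bg; apply/evE; rewrite Hb //.
(* A rational point of the subbox leads to a database, where genericity shows that b is true. *)
have [g' [D' [bg' DD']]] := rat c eps e0.
rewrite -(Hb g' bg'); apply/evE.
by apply/(moved_holds_database _ QD _ DD') => //; apply: valid_near_one; apply: sub.
Qed.

End Agreement.

(** * Triangles are determined by their drawing and center of mass *)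

Section DrawingCenter.
Variable R : realType.
Implicit Types (p q : stpoint R) (t : triangle R).

(* Nonnegativity for the lexicographic order on the plane. *)
Definition lex0 (x y : R) := 0 < x \/ x = 0 /\ 0 <= y.

Definition lexle p q := lex0 (px q - px p) (py q - py p).

Lemma lex0_add x y x' y' : lex0 x y -> lex0 x' y' -> lex0 (x + x') (y + y').
Proof.
move=> [h|[-> h]] [h'|[-> h']].
- by left; apply: addr_gt0.
- by left; rewrite addr0.
- by left; rewrite add0r.
- by right; split; rewrite ?addr0 ?addr_ge0.
Qed.

Lemma lex0_scale w x y : 0 <= w -> lex0 x y -> lex0 (w * x) (w * y).
Proof.
rewrite le_eqVlt => /predU1P[<- _|w0 [x0|[-> y0]]].
- by right; rewrite !mul0r.
- by left; apply: mulr_gt0.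
- by right; rewrite mulr0; split=> //; apply: mulr_ge0 => //; apply: ltW.
Qed.

Lemma lex0_total x y : lex0 x y \/ lex0 (- x) (- y).
Proof.
case: (ltrgtP 0 x) => [h|h|<-]; [by left; left|by right; left; rewrite oppr_gt0|].
by case: (lerP 0 y) => h; [left|right]; right; rewrite ?oppr0 // oppr_ge0 ltW.
Qed.

Lemma lex0_anti x y : lex0 x y -> lex0 (- x) (- y) -> x = 0 /\ y = 0.
Proof. by rewrite /lex0; move=> [h|[e h]] [h'|[e' h']]; split; lra. Qed.

Lemma lexle_total p q : lexle p q \/ lexle q p.
Proof.
rewrite /lexle -(opprB (px q)) -(opprB (py q)); exact: lex0_total.
Qed.

Lemma lexle_trans p q r : lexle p q -> lexle q r -> lexle p r.
Proof.
move=> h h'; have := lex0_add h' h.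
by rewrite /lexle !addrA !subrK.
Qed.

(** The vectors that are nonnegative in the lexicographic order form a convex cone, so bounds on the
    corners pass to their hull. The Boolean selects lower or upper bounds. *)
Lemma lexle_drawing t p q (b : bool) : drawing t p ->
  (forall i, if b then lexle q (cor t i) else lexle (cor t i) q) ->
  if b then lexle q p else lexle p q.
Proof.
move=> /drawingE[_ [w [w0 w1 ex ey]]].
have sumE (x : 'I_3 -> R) c : \sum_i w i * x i - c = \sum_i w i * (x i - c).
  under [RHS]eq_bigr do rewrite mulrBr.
  by rewrite sumrB -[in RHS]big_distrl /= w1 mul1r.
have lexS (x y : 'I_3 -> R) : (forall i, lex0 (x i) (y i)) ->
    lex0 (\sum_i w i * x i) (\sum_i w i * y i).
  move=> H; rewrite !big_ord_recl !big_ord0 !addr0.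
  by do ! apply: lex0_add; apply: lex0_scale.
case: b => H; rewrite /lexle ex ey.
  by rewrite !sumE; apply: lexS.
have subE (x : 'I_3 -> R) c : c - \sum_i w i * x i = \sum_i w i * (c - x i).
  by rewrite -opprB sumE -sumrN; apply: eq_bigr => i _; rewrite -mulrN opprB.
by rewrite !subE; apply: lexS.
Qed.

Lemma lex_sort t : exists s : 'S_3, forall i j : 'I_3, (i <= j)%N ->
  lexle (cor (permute_corners t s) i) (cor (permute_corners t s) j).
Proof.
pose a : 'I_3 := ord0; pose b : 'I_3 := inord 1; pose c : 'I_3 := inord 2.
have refl p : lexle p p by right; rewrite !subrr.
have ord3 (i : 'I_3) : [\/ i = a, i = b | i = c].
  case: i => [[|[|[|//]]] lt]; [apply: Or31|apply: Or32|apply: Or33];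
    by apply: val_inj; rewrite /= ?inordK.
have vb : b = 1%N :> nat by rewrite /b inordK.
have vc : c = 2%N :> nat by rewrite /c inordK.
have ab : a == b = false by rewrite -val_eqE /= vb.
have ba : b == a = false by rewrite -val_eqE /= vb.
have ac : a == c = false by rewrite -val_eqE /= vc.
have ca : c == a = false by rewrite -val_eqE /= vc.
have bc : b == c = false by rewrite -val_eqE /= vb vc.
have cb : c == b = false by rewrite -val_eqE /= vb vc.
suff [s [H1 H2]] : exists s : 'S_3, lexle (cor t (s a)) (cor t (s b)) /\
    lexle (cor t (s b)) (cor t (s c)).
  exists s => i j; rewrite !cor_perm.
  have H3 := lexle_trans H1 H2.
  by case: (ord3 i) => ->; case: (ord3 j) => -> //; rewrite ?vb ?vc.
have sE := (permM, permE, perm1, eqxx, ab, ba, ac, ca, bc, cb).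
have [hab|hba] := lexle_total (cor t a) (cor t b);
have [hbc|hcb] := lexle_total (cor t b) (cor t c);
have [hac|hca] := lexle_total (cor t a) (cor t c).
- by exists 1%g; rewrite !perm1.
- by exists 1%g; rewrite !perm1.
- by exists (tperm b c); rewrite !sE /= ?sE.
- by exists (tperm b c * tperm a c)%g; rewrite !sE /= ?sE /= ?sE.
- by exists (tperm a b); rewrite !sE /= ?sE.
- by exists (tperm a b * tperm a c)%g; rewrite !sE /= ?sE /= ?sE.
- by exists (tperm a c); rewrite !sE /= ?sE.
- by exists (tperm a c); rewrite !sE /= ?sE.
Qed.

(** The lexicographically least and greatest points of a drawing are corners, so after sorting the
    first and last corners agree, and the center of mass fixes the middle one. This also covers
    degenerate triangles, where the middle corner may be invisible in the drawing. *)
Lemma drawing_center_perm t t' : drawing t = drawing t' ->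
  cx t = cx t' -> cy t = cy t' -> exists s, permute_corners t s = t'.
Proof.
move=> dE xE yE; have [s Hs] := lex_sort t; have [s' Hs'] := lex_sort t'.
set t1 := permute_corners t s in Hs; set t1' := permute_corners t' s' in Hs'.
have d1 : drawing t1 = drawing t1' by rewrite !drawing_perm.
have cor0 u u' : drawing u = drawing u' ->
    (forall i j : 'I_3, (i <= j)%N -> lexle (cor u i) (cor u j)) ->
    lexle (cor u ord0) (cor u' ord0) /\ lexle (cor u' ord_max) (cor u ord_max).
  move=> du Hu; split.
    apply: (@lexle_drawing u _ _ true) => [|i]; last exact: Hu.
    by rewrite du; apply: drawing_cor.
  apply: (@lexle_drawing u _ _ false) => [|i]; last by apply: Hu; rewrite -ltnS.
  by rewrite du; apply: drawing_cor.
have anti p q : p.2 = q.2 -> lexle p q -> lexle q p -> p = q.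
  rewrite /lexle -(opprB (px q)) -(opprB (py q)) => e2 h h'.
  by have [/subr0_eq ex /subr0_eq ey] := lex0_anti h h'; apply: eq_pt.
have [a1 a2] := cor0 _ _ d1 Hs; have [b1 b2] := cor0 _ _ (esym d1) Hs'.
have tE : tri_time t1 = tri_time t1'.
  have : drawing t1' (cor t1 ord0) by rewrite -d1; apply: drawing_cor.
  by move=> /drawingE[]; rewrite cor_time.
have e0 : cor t1 ord0 = cor t1' ord0 by apply: anti; rewrite ?cor_time.
have e2 : cor t1 ord_max = cor t1' ord_max by apply: anti; rewrite ?cor_time.
have n3 : (3^-1 : R) != 0 by rewrite invr_eq0 pnatr_eq0.
have sumP u (s0 : 'S_3) (F : stpoint R -> R) :
    \sum_i F (cor (permute_corners u s0) i) = \sum_i F (cor u i).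
  rewrite [RHS](reindex_inj (@perm_inj _ s0)) /=.
  by apply: eq_bigr => i _; rewrite cor_perm.
have e1 : cor t1 (lift ord0 ord0) = cor t1' (lift ord0 ord0).
  have mE : lift ord0 (lift ord0 ord0) = ord_max :> 'I_3 by apply: val_inj.
  apply: eq_pt; last by rewrite !cor_time.
    have := mulfI n3 xE; rewrite -(sumP t s) -(sumP t' s') -/t1 -/t1'.
    by rewrite !big_ord_recl !big_ord0 mE e0 e2 => /addrI/addIr.
  have := mulfI n3 yE; rewrite -(sumP t s) -(sumP t' s') -/t1 -/t1'.
  by rewrite !big_ord_recl !big_ord0 mE e0 e2 => /addrI/addIr.
have e : t1 = t1'.
  apply: triangle_inj => i; case: (unliftP ord0 i) => [j|] -> //.
  case: (unliftP ord0 j) => [l|] -> //.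
  by rewrite (ord1 l); have -> : lift ord0 (lift ord0 ord0) = ord_max :> 'I_3 by apply: val_inj.
exists (s'^-1 * s)%g; apply: triangle_inj => i; rewrite cor_perm permM.
have := congr1 (fun u => cor u ((s'^-1)%g i)) e.
by rewrite !cor_perm permKV.
Qed.

(** The first two conditions make the drawing of t the least one containing all p i, hence their
    hull; the other two fix the center of mass. All four can be expressed in the triangle
    language. *)
Lemma corners_charact t (p : 'I_3 -> stpoint R) :
  (exists s, forall i, cor (permute_corners t s) i = p i) <->
  [/\ forall i, drawing t (p i),
      forall t', (forall i, drawing t' (p i)) -> PartOf_cotemp t t',
      cx t = 3^-1 * \sum_i px (p i) & cy t = 3^-1 * \sum_i py (p i)].
Proof.
split=> [[s H]|[H1 H2 ex ey]].
  split=> [i|t' H'||].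
  - by rewrite -H cor_perm; apply: drawing_cor.
  - apply/PartOfE => i; have := H' ((s^-1)%g i).
    by rewrite -H cor_perm permKV.
  - congr (_ * _); rewrite (reindex_inj (@perm_inj _ s)) /=.
    by apply: eq_bigr => i _; rewrite -H cor_perm.
  - congr (_ * _); rewrite (reindex_inj (@perm_inj _ s)) /=.
    by apply: eq_bigr => i _; rewrite -H cor_perm.
(* Lying in the drawing of t, the p i share its time and are therefore the corners of a triangle. *)
pose t' := mktri (fun i => px (p i)) (fun i => py (p i)) (tri_time t).
have cE i : cor t' i = p i.
  rewrite cor_mktri -[RHS]mkpt_eta; congr mkpt.
  by have /drawingE[->] := H1 i.
have [|||s Hs] := @drawing_center_perm t t'.
- apply/seteqP; split; first by apply: H2 => i; rewrite -cE; apply: drawing_cor.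
  by apply: drawing_sub => i; rewrite cE.
- by rewrite ex /cx; under [in RHS]eq_bigr do rewrite cE.
- by rewrite ey /cy; under [in RHS]eq_bigr do rewrite cE.
by exists s => i; rewrite Hs cE.
Qed.

End DrawingCenter.

(** * Arithmetic on times in the triangle language *)

Section Geometry.
Variable R : realType.
Implicit Types (p : stpoint R) (t a b z o w : triangle R).

Definition cotemp a b := Before a b /\ Before b a.
(** Two co-temporal triangles with equal velocities towards a common later z must start from the
    same place. *)
Definition same_center a b := cotemp a b /\ exists z, SAS a z b z.
(** The parallel to ow through a. As [SAS] orders times strictly, each temporal order of a and b
    needs its own case, and simultaneity on a non-horizontal line means coincidence. *)
Definition on_line o w a b := same_center a b \/ (SAS o w a b \/ SAS o w b a).
Definition is_point t := forall a, PartOf_cotemp a t -> PartOf_cotemp t a.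

Lemma cotempE a b : cotemp a b <-> tri_time a = tri_time b.
Proof.
rewrite /cotemp /Before; split=> [[ab ba]|->//].
by apply/eqP; rewrite eq_le ab.
Qed.

Lemma cx_pttri p : cx (pttri p) = px p.
Proof.
rewrite /cx; under eq_bigr do rewrite cor_pttri.
by rewrite sumr_const card_ord; field.
Qed.

Lemma cy_pttri p : cy (pttri p) = py p.
Proof.
rewrite /cy; under eq_bigr do rewrite cor_pttri.
by rewrite sumr_const card_ord; field.
Qed.

Lemma same_centerE a b : same_center a b <->
  [/\ cx a = cx b, cy a = cy b & tri_time a = tri_time b].
Proof.
rewrite /same_center cotempE; split=> [[e [z /SASE[lt _]]]|[ex ey e]].
  rewrite -e => h1 h2; have n : tri_time z - tri_time a != 0.
    by rewrite subr_eq0 eq_sym lt_eqF.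
  have := mulIf n h1; have := mulIf n h2.
  by move=> /addrI/oppr_inj -> /addrI/oppr_inj ->.
split=> //; exists (pttri (mkpt 0 0 (tri_time a + 1))); apply/SASE.
by rewrite time_pttri /= -e ex ey ltrDl ltr01.
Qed.

Lemma on_lineE o w a b : tri_time o < tri_time w -> on_line o w a b <->
  (cx b - cx a) * (tri_time w - tri_time o) =
    (cx w - cx o) * (tri_time b - tri_time a) /\
  (cy b - cy a) * (tri_time w - tri_time o) =
    (cy w - cy o) * (tri_time b - tri_time a).
Proof.
move=> ow; rewrite /on_line same_centerE !SASE; split.
  move=> [[-> -> ->]|[[_ _ <- <-]//|[_ _ h1 h2]]].
    by rewrite !subrr !mul0r !mulr0.
  by split; lra.
move=> [ex ey]; have n : tri_time w - tri_time o != 0.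
  by rewrite subr_eq0 eq_sym lt_eqF.
case: (ltrgtP (tri_time a) (tri_time b)) => [lt|lt|e].
- by right; left.
- by right; right; split=> //; lra.
- move: ex ey; rewrite e subrr !mulr0 => /eqP; rewrite mulf_eq0 (negPf n) orbF.
  rewrite subr_eq0 => /eqP ex /eqP; rewrite mulf_eq0 (negPf n) orbF.
  by rewrite subr_eq0 => /eqP ey; left.
Qed.

Lemma is_pointE t : is_point t <-> exists p, t = pttri p.
Proof.
split=> [H|[p ->] a].
  have sub : PartOf_cotemp (pttri (cor t ord0)) t.
    by apply/PartOfE => i; rewrite cor_pttri; apply: drawing_cor.
  exists (cor t ord0); apply: triangle_inj => i; rewrite cor_pttri.
  have := H _ sub _ (drawing_cor t i).
  by rewrite drawing_pttri.
rewrite /PartOf_cotemp drawing_pttri => H q /= ->.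
by rewrite -(H _ (drawing_cor a ord0)); apply: drawing_cor.
Qed.

(* The standard frame. The signs make cx + time, resp. cy + time, constant along
   the lines from fo towards fx, resp. fy. *)
Definition fo := pttri (mkpt (0 : R) 0 0).
Definition fw := pttri (mkpt (0 : R) 0 1).
Definition fx := pttri (mkpt (- 1 : R) 0 1).
Definition fy := pttri (mkpt (0 : R) (- 1) 1).

Lemma coord_fo : (cx fo = 0) * (cy fo = 0) * (tri_time fo = 0).
Proof. by rewrite cx_pttri cy_pttri time_pttri px_mkpt py_mkpt. Qed.
Lemma coord_fw : (cx fw = 0) * (cy fw = 0) * (tri_time fw = 1).
Proof. by rewrite cx_pttri cy_pttri time_pttri px_mkpt py_mkpt. Qed.
Lemma coord_fx : (cx fx = - 1) * (cy fx = 0) * (tri_time fx = 1).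
Proof. by rewrite cx_pttri cy_pttri time_pttri px_mkpt py_mkpt. Qed.
Lemma coord_fy : (cx fy = 0) * (cy fy = - 1) * (tri_time fy = 1).
Proof. by rewrite cx_pttri cy_pttri time_pttri px_mkpt py_mkpt. Qed.

Definition coord_frame := (coord_fo, coord_fw, coord_fx, coord_fy).

Lemma on_line_w a b : on_line fo fw a b <-> cx a = cx b /\ cy a = cy b.
Proof.
rewrite on_lineE !coord_frame ?ltr01 //; split=> -[h1 h2]; split; lra.
Qed.

Lemma on_line_x a b : on_line fo fx a b <->
  cx a + tri_time a = cx b + tri_time b /\ cy a = cy b.
Proof.
rewrite on_lineE !coord_frame ?ltr01 //; split=> -[h1 h2]; split; lra.
Qed.

Lemma on_line_y a b : on_line fo fy a b <->
  cx a = cx b /\ cy a + tri_time a = cy b + tri_time b.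
Proof.
rewrite on_lineE !coord_frame ?ltr01 //; split=> -[h1 h2]; split; lra.
Qed.

(* With times a and b, the points u0 .. u3 are (0, 0, a), (a, 0, 0), (a, 0, b) and
   (a, b, 0). *)
Definition center_at t a b z := exists u0 u1 u2 u3,
  (on_line fo fw fo u0 /\ cotemp u0 a) /\
  (on_line fo fx u0 u1 /\ cotemp u1 fo) /\
  (on_line fo fw u1 u2 /\ cotemp u2 b) /\
  (on_line fo fy u2 u3 /\ cotemp u3 fo) /\
  (on_line fo fw u3 t /\ cotemp t z).

Lemma center_atE t a b z : center_at t a b z <->
  [/\ cx t = tri_time a, cy t = tri_time b & tri_time t = tri_time z].
Proof.
split=> [[u0 [u1 [u2 [u3]]]]|[ex ey e]].
  rewrite !on_line_w !on_line_x !on_line_y !cotempE !coord_frame.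
  move=> [[[? ?] ?] [[[? ?] ?] [[[? ?] ?] [[[? ?] ?] [[? ?] ?]]]]].
  by split; lra.
exists (pttri (mkpt 0 0 (tri_time a))), (pttri (mkpt (tri_time a) 0 0)),
  (pttri (mkpt (tri_time a) 0 (tri_time b))),
  (pttri (mkpt (tri_time a) (tri_time b) 0)).
rewrite !on_line_w !on_line_x !on_line_y !cotempE !coord_frame.
rewrite !(cx_pttri, cy_pttri, time_pttri, px_mkpt, py_mkpt) /= ex ey e.
by do ! split; lra.
Qed.

(** The centers are (b, 0, a) and (0, 0, z). Along the direction of [fx] the sum of first coordinate
    and time is constant, so they are on one such line iff z = a + b. *)
Definition time_add a b z := exists t1 t2,
  center_at t1 b fo a /\ center_at t2 fo fo z /\ on_line fo fx t1 t2.

Lemma time_addE a b z : time_add a b z <-> tri_time z = tri_time a + tri_time b.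
Proof.
split=> [[t1 [t2 [/center_atE[e1 e2 e3] [/center_atE[e4 e5 e6]]]]]|e].
  by move: e4 e5; rewrite on_line_x !coord_frame => ? ? [? ?]; lra.
exists (pttri (mkpt (tri_time b) 0 (tri_time a))), (pttri (mkpt 0 0 (tri_time z))).
rewrite !center_atE on_line_x !coord_frame.
rewrite !(cx_pttri, cy_pttri, time_pttri, px_mkpt, py_mkpt) /=.
by do ! split; lra.
Qed.

(* (b, 0, 1) and (z, 0, a) lie on a line through the origin iff z = a * b. *)
Definition time_mul a b z := exists t1 t2,
  center_at t1 b fo fw /\ center_at t2 z fo a /\ on_line fo t1 fo t2.

Lemma time_mulE a b z : time_mul a b z <-> tri_time z = tri_time a * tri_time b.
Proof.
split=> [[t1 [t2 [/center_atE[e1 e2 e3] [/center_atE[e4 e5 e6]]]]]|e].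
  move: e3; rewrite coord_frame => e3.
  rewrite on_lineE coord_frame ?e3 ?ltr01 // => -[h _].
  by move: h; rewrite e1 e4 e6 !coord_frame !subr0 mulr1 mulrC.
exists (pttri (mkpt (tri_time b) 0 1)), (pttri (mkpt (tri_time z) 0 (tri_time a))).
rewrite !center_atE on_lineE ?time_pttri ?coord_frame ?ltr01 //.
rewrite !(cx_pttri, cy_pttri, time_pttri, px_mkpt, py_mkpt) /= e.
by do ! split; rewrite ?subr0 ?mulr1 ?mul0r // mulrC.
Qed.

(* [o, w, x, y] is a frame when the spatial part of x - w and y - w is a basis:
   lines in the directions w, x and y from o then lead to every point. *)
Definition frame o w x y :=
  ((is_point o /\ is_point w) /\ (is_point x /\ is_point y)) /\
  (~ Before w o /\ (cotemp w x /\ cotemp w y)) /\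
  forall t, exists t1 t2,
    on_line o w o t1 /\ (on_line o x t1 t2 /\ on_line o y t2 t).

Lemma frame_std : frame fo fw fx fy.
Proof.
have pt p : is_point (pttri p) by apply/is_pointE; exists p.
split; first by do ! split; apply: pt.
split; first by rewrite !cotempE !coord_frame /Before !coord_frame; split=> //; rewrite ler10.
(* Found by walking back from t: first along y, preserving cy + time, until cy is 0, then along x,
   preserving cx + time, until cx is 0. *)
move=> t; exists (pttri (mkpt 0 0 (tri_time t + cx t + cy t))).
exists (pttri (mkpt (cx t) 0 (tri_time t + cy t))).
rewrite !on_line_w !on_line_x !on_line_y !coord_frame.
rewrite !(cx_pttri, cy_pttri, time_pttri, px_mkpt, py_mkpt) /=.
by do ! split; lra.
Qed.

Lemma frame_act_std o w x y : frame o w x y -> exists2 g, valid g &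
  [/\ o = act g fo, w = act g fw, x = act g fx & y = act g fy].
Proof.
move=> [[[/is_pointE[o' ->] /is_pointE[w' ->]] [/is_pointE[x' ->] /is_pointE[y' ->]]]].
rewrite /Before !cotempE !time_pttri => -[[/negP]]; rewrite -ltNge => ow [ex ey] span.
(* The image of [fo] determines b and beta, that of [fw] then c and alpha. As [fx] and [fy] differ
   from [fw] by minus the unit vectors, the columns of M are w' - x' and w' - y'. *)
pose g : 10.-tuple R := [tuple px w' - px x'; px w' - px y'; py w' - py x'; py w' - py y';
  px o'; py o'; px w' - px o'; py w' - py o'; w'.2 - o'.2; o'.2].
exists g; last first.
  by split; apply: triangle_inj => i; rewrite cor_act !cor_pttri; apply: eq_pt;
    rewrite /act_pt /= ?(px_mkpt, py_mkpt) /=; lra.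
split; first by rewrite /= subr_gt0.
have a0 : w'.2 - o'.2 != 0 by rewrite lt0r_neq0 // subr_gt0.
(* Surjectivity of M: the target o' - e has the time of o', so the three durations add up to 0 and
   the leg along w can be eliminated. The durations along x and y, divided by that from o' to w',
   are the solution. *)
have solve e1 e2 : exists l m, g`_0 * l + g`_1 * m = e1 /\ g`_2 * l + g`_3 * m = e2.
  have [t1 [t2]] := span (pttri (mkpt (px o' - e1) (py o' - e2) o'.2)).
  rewrite !on_lineE ?time_pttri -?ex -?ey //.
  rewrite !(cx_pttri, cy_pttri, time_pttri, px_mkpt, py_mkpt) /= -?ex -?ey.
  move=> [[h1 h2] [[h3 h4] [h5 h6]]].
  exists ((tri_time t2 - tri_time t1) / (w'.2 - o'.2)),
         ((o'.2 - tri_time t2) / (w'.2 - o'.2)).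
  by split; apply: (mulIf a0); rewrite mulrDl !mulrA !divfK //; lra.
have [l1 [m1 [h1 h2]]] := solve 1 0; have [l2 [m2 [h3 h4]]] := solve 0 1.
(* Multiplicativity of the determinant: M times the matrix of solutions is the identity. *)
apply/eqP => d0; have : (g`_0 * g`_3 - g`_1 * g`_2) * (l1 * m2 - l2 * m1) = 1.
  rewrite -[RHS](_ : (g`_0 * l1 + g`_1 * m1) * (g`_2 * l2 + g`_3 * m2) -
     (g`_0 * l2 + g`_1 * m2) * (g`_2 * l1 + g`_3 * m1) = 1); first by ring.
  by rewrite h1 h2 h3 h4; ring.
by rewrite d0 mul0r => /eqP; rewrite eq_sym oner_eq0.
Qed.

Definition is_corners t (v : nat -> R) :=
  exists s, forall i, (i < 9)%N -> tcoord (permute_corners t s) i = v i.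

(** First-order rendering of [corners_charact]: point-triangles stand for the corners, and the times
    of x and y are the spatial coordinates of the center of mass, compared after multiplication by 3
    to avoid a division. *)
Definition corners_at t (a : nat -> triangle R) := exists p : 3.-tuple (triangle R),
  (forall j, is_point (tnth p j) /\
     center_at (tnth p j) (a (3 * j)%N) (a (3 * j).+1) (a (3 * j).+2)) /\
  (forall j, PartOf_cotemp (tnth p j) t) /\
  (forall t', (forall j, PartOf_cotemp (tnth p j) t') -> PartOf_cotemp t t') /\
  exists x y z, center_at t x y z /\
    (\sum_(j < 3) tri_time (a (3 * j)%N) = tri_time x *+ 3 /\
     \sum_(j < 3) tri_time (a (3 * j).+1) = tri_time y *+ 3).

Lemma corners_atE t (a : nat -> triangle R) : corners_at t a <-> is_corners t (fun i => tri_time (a i)).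
Proof.
have n3 : (3 : R) != 0 by rewrite pnatr_eq0.
have ptE (p : triangle R) q : is_point p /\ cx p = px q /\ cy p = py q /\ tri_time p = q.2
    <-> p = pttri q.
  split=> [[/is_pointE[q' ->]]|->].
    rewrite cx_pttri cy_pttri time_pttri => -[h1 [h2 h3]].
    by congr pttri; apply: eq_pt.
  by rewrite cx_pttri cy_pttri time_pttri; split=> //; apply/is_pointE; exists q.
have partE q t' : PartOf_cotemp (pttri q) t' <-> drawing t' q.
  by rewrite PartOfE; split=> [/(_ ord0)|H i]; rewrite cor_pttri.
pose v i := tri_time (a i).
pose q (j : 'I_3) := mkpt (v (3 * j)%N) (v (3 * j).+1) (v (3 * j).+2).
have cornE : is_corners t v <-> exists s, forall i, cor (permute_corners t s) i = q i.
  split=> -[s H]; exists s.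
    move=> j; have j3 := ltn_ord j; have [e1 e2 e3] := tcoordE (permute_corners t s) j.
    apply: eq_pt; rewrite ?px_mkpt ?py_mkpt ?cor_time /=.
    - by rewrite -e1 H //; lia.
    - by rewrite -e2 H //; lia.
    - by rewrite -e3 H //; lia.
  move=> i i9; have lt : (i %/ 3 < 3)%N by lia.
  have e : i = (3 * (i %/ 3) + i %% 3)%N by lia.
  rewrite /tcoord H /q inordK //.
  have : (i %% 3 < 3)%N by rewrite ltn_mod.
  case: (i %% 3)%N e => [|[|[|//]]] e _ /=; rewrite ?mxE /=.
  - by congr v; lia.
  - by congr v; lia.
  - by congr v; lia.
rewrite -/v cornE corners_charact; split.
  move=> [p [Hp [H1 [H2 [x [y [z [/center_atE[c1 c2 c3] [s1 s2]]]]]]]]].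
  have pE j : tnth p j = pttri (q j).
    by apply/ptE; have [h /center_atE[h1 h2 h3]] := Hp j; rewrite h1 h2 h3 px_mkpt py_mkpt.
  split.
  - by move=> i; apply/partE; rewrite -pE.
  - by move=> t' H'; apply: H2 => j; rewrite pE; apply/partE.
  - under eq_bigr do rewrite px_mkpt.
    by rewrite s1 c1; field.
  - under eq_bigr do rewrite py_mkpt.
    by rewrite s2 c2; field.
move=> [H1 H2 ex ey]; exists [tuple pttri (q j) | j < 3]; split.
  move=> j; rewrite tnth_mktuple.
  have /ptE[h [h1 [h2 h3]]] := erefl (pttri (q j)); split=> //.
  by apply/center_atE; rewrite h1 h2 h3 px_mkpt py_mkpt.
split; first by move=> j; rewrite tnth_mktuple; apply/partE.
split.
  move=> t' H'; apply: H2 => i; have := H' i; rewrite tnth_mktuple.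
  by move/partE.
exists (pttri (mkpt 0 0 (cx t))), (pttri (mkpt 0 0 (cy t))), t.
rewrite center_atE !time_pttri /= ex ey; split=> //; split.
  under [in RHS]eq_bigr do rewrite px_mkpt.
  by rewrite /v; field.
under [in RHS]eq_bigr do rewrite py_mkpt.
by rewrite /v; field.
Qed.

End Geometry.

(** * Completeness *)

(* The binders on which a projection does not depend are found by reducing it on a
   pair of variables. *)
Ltac isvar_tac :=
  lazymatch goal with
  | |- isvar (@ctx1 ?X ?C ?N ?e) ?a =>
    let b := eval cbv beta iota delta [fst snd] in (fun (x : X) (c : C) => a (x, c)) in
    lazymatch b with
    | (fun x _ => x) => exact (isvar_new e)
    | (fun _ => ?d) => refine (@isvar_ctx1 X C N e d _); isvar_tac
    end
  | |- isvar (@ctxs ?X ?m ?C ?N ?e) ?a =>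
    let b := eval cbv beta iota delta [fst snd] in
      (fun (x : m.-tuple X) (c : C) => a (x, c)) in
    lazymatch b with
    | (fun x _ => tnth x ?i) => exact (isvar_news e i)
    | (fun _ => ?d) => refine (@isvar_ctxs X C N e m d _); isvar_tac
    end
  | |- _ => solve [auto]
  end.

(** * Real formulas evaluated on the times of triangles *)

Section TriangleDefinable.
Variables (R : realType) (sigma : schema).

Notation tdef := (@definable (tri_atom sigma) (triangle R) (pstruct R sigma)
  (@tri_psat R sigma)).

Lemma tdef_forall C N (e : C -> N.-tuple (triangle R)) n
    (P : 'I_n -> pstruct R sigma -> C -> Prop) :
  (forall i, tdef e (P i)) -> tdef e (fun D c => forall i, P i D c).
Proof. exact: def_forall (fun n => TBefore sigma ord0 ord0) _ _ _ _ _. Qed.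

Section Atoms.
Variables (C : Type) (N : nat) (e : C -> N.-tuple (triangle R)).
Implicit Types a b o w : C -> triangle R.

Lemma def_Before a b : isvar e a -> isvar e b -> tdef e (fun _ c => Before (a c) (b c)).
Proof.
by move=> [i Hi] [j Hj]; exists (Atom (TBefore _ i j)) => D c /=; rewrite Hi Hj.
Qed.

Lemma def_part a b : isvar e a -> isvar e b ->
  tdef e (fun _ c => PartOf_cotemp (a c) (b c)).
Proof.
by move=> [i Hi] [j Hj]; exists (Atom (TPartOf _ i j)) => D c /=; rewrite Hi Hj.
Qed.

Lemma def_sas a b o w : isvar e a -> isvar e b -> isvar e o -> isvar e w ->
  tdef e (fun _ c => SAS (a c) (b c) (o c) (w c)).
Proof.
move=> [i Hi] [j Hj] [k Hk] [l Hl].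
by exists (Atom (TSAS _ i j k l)) => D c; rewrite Hi Hj Hk Hl.
Qed.

Lemma def_set (r : relname sigma) (T : C -> (arity r).-tuple (triangle R)) :
  (forall j, isvar e (fun c => tnth (T c) j)) -> tdef e (fun D c => @ps_set _ _ D r (T c)).
Proof.
move=> /boolp.choice[i Hi]; exists (Atom (TRel [tuple i j | j < arity r])) => D c /=.
rewrite (_ : map_tuple _ _ = T c) //; apply: eq_from_tnth => j.
by rewrite tnth_map tnth_mktuple Hi.
Qed.

Lemma def_cotemp a b : isvar e a -> isvar e b -> tdef e (fun _ c => cotemp (a c) (b c)).
Proof. by move=> va vb; apply: def_and; apply: def_Before. Qed.

End Atoms.

Lemma def_same_center C N (e : C -> N.-tuple (triangle R)) a b :
  isvar e a -> isvar e b -> tdef e (fun _ c => same_center (a c) (b c)).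
Proof.
move=> va vb; apply: def_and; first exact: def_cotemp.
by apply: def_ex; apply: def_sas; isvar_tac.
Qed.

Lemma def_on_line C N (e : C -> N.-tuple (triangle R)) o w a b :
  isvar e o -> isvar e w -> isvar e a -> isvar e b ->
  tdef e (fun _ c => on_line (o c) (w c) (a c) (b c)).
Proof.
move=> vo vw va vb; apply: def_or; first exact: def_same_center.
by apply: def_or; apply: def_sas.
Qed.

Lemma def_is_point C N (e : C -> N.-tuple (triangle R)) a :
  isvar e a -> tdef e (fun _ c => is_point (a c)).
Proof. by move=> va; apply: def_all; apply: def_imp; apply: def_part; isvar_tac. Qed.

Lemma def_frame C N (e : C -> N.-tuple (triangle R)) o w x y :
  isvar e o -> isvar e w -> isvar e x -> isvar e y ->
  tdef e (fun _ c => frame (o c) (w c) (x c) (y c)).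
Proof.
move=> vo vw vx vy; apply: def_and.
  by apply: def_and; apply: def_and; apply: def_is_point.
apply: def_and.
  apply: def_and; first by apply: def_not; apply: def_Before.
  by apply: def_and; apply: def_cotemp.
apply: def_all; apply: def_ex; apply: def_ex.
by apply: def_and; last apply: def_and; apply: def_on_line; isvar_tac.
Qed.

(** The language has no constants, so the standard frame is supplied through variables, which can
    later be given any other frame as values. *)
Definition frame_vars C N (e : C -> N.-tuple (triangle R)) :=
  [/\ isvar e (fun=> fo R), isvar e (fun=> fw R), isvar e (fun=> fx R)
    & isvar e (fun=> fy R)].

Lemma frame_ctx1 C N (e : C -> N.-tuple (triangle R)) :
  frame_vars e -> frame_vars (ctx1 e).
Proof. by move=> [*]; split; isvar_tac. Qed.

Lemma frame_ctxs m C N (e : C -> N.-tuple (triangle R)) :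
  frame_vars e -> frame_vars (@ctxs _ m _ _ e).
Proof. by move=> [*]; split; isvar_tac. Qed.

Lemma def_center_at C N (e : C -> N.-tuple (triangle R)) t a b z :
  frame_vars e -> isvar e t -> isvar e a -> isvar e b -> isvar e z ->
  tdef e (fun _ c => center_at (t c) (a c) (b c) (z c)).
Proof.
move=> [v0 v1 v2 v3] vt va vb vz; do 4 apply: def_ex.
by do 4 (apply: def_and; first by
     (apply: def_and; [apply: def_on_line|apply: def_cotemp]; isvar_tac));
  apply: def_and; [apply: def_on_line|apply: def_cotemp]; isvar_tac.
Qed.

Lemma def_time_add C N (e : C -> N.-tuple (triangle R)) a b z :
  frame_vars e -> isvar e a -> isvar e b -> isvar e z ->
  tdef e (fun _ c => time_add (a c) (b c) (z c)).
Proof.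
move=> fv va vb vz; have := frame_ctx1 (frame_ctx1 fv); have [v0 v1 v2 v3] := fv => fv2.
apply: def_ex; apply: def_ex; apply: def_and; last apply: def_and.
- by apply: def_center_at => //; isvar_tac.
- by apply: def_center_at => //; isvar_tac.
- by apply: def_on_line; isvar_tac.
Qed.

Lemma def_time_mul C N (e : C -> N.-tuple (triangle R)) a b z :
  frame_vars e -> isvar e a -> isvar e b -> isvar e z ->
  tdef e (fun _ c => time_mul (a c) (b c) (z c)).
Proof.
move=> fv va vb vz; have := frame_ctx1 (frame_ctx1 fv); have [v0 v1 v2 v3] := fv => fv2.
apply: def_ex; apply: def_ex; apply: def_and; last apply: def_and.
- by apply: def_center_at => //; isvar_tac.
- by apply: def_center_at => //; isvar_tac.
- by apply: def_on_line; isvar_tac.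
Qed.

Definition times n (rho : n.-tuple (triangle R)) : n.-tuple R :=
  map_tuple (@tri_time R) rho.

Lemma ex_time (P : R -> Prop) :
  (exists x, P x) <-> (exists t : triangle R, P (tri_time t)).
Proof.
split=> [[x Px]|[t Pt]]; last by exists (tri_time t).
by exists (pttri (mkpt 0 0 x)); rewrite time_pttri.
Qed.

(** Each intermediate value of the polynomial is named by the time of a quantified triangle. *)
Lemma def_zpoly n (p : zpoly n) C N (e : C -> N.-tuple (triangle R))
    (rho : C -> n.-tuple (triangle R)) z : frame_vars e ->
  (forall i, isvar e (fun c => tnth (rho c) i)) -> isvar e z ->
  tdef e (fun _ c => tri_time (z c) = zpoly_eval p (times (rho c))).
Proof.
elim: p C N e rho z => [i|||p IH|p IHp q IHq|p IHp q IHq] C N e rho z fv vr vz /=.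
- apply: (def_eqv _ (def_cotemp vz (vr i))) => D c.
  by rewrite cotempE tnth_map.
- have [v0 _ _ _] := fv; apply: (def_eqv _ (def_cotemp vz v0)) => D c.
  by rewrite cotempE coord_fo.
- have [_ v1 _ _] := fv; apply: (def_eqv _ (def_cotemp vz v1)) => D c.
  by rewrite cotempE coord_fw.
(* A negation z = -u is expressed as u + z = 0. *)
- apply: (@def_eqv _ _ _ _ _ _ _ (fun D c => exists u,
    tri_time u = zpoly_eval p (times (rho c)) /\ time_add u (z c) (fo R))).
    move=> D c; split=> [[u [<-]]|H]; first by rewrite time_addE coord_fo; lra.
    exists (pttri (mkpt 0 0 (zpoly_eval p (times (rho c))))).
    by rewrite time_addE time_pttri coord_fo; split=> //=; lra.
  have [v0 _ _ _] := fv; apply: def_ex; apply: def_and.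
    apply: (IH _ _ _ (fun xc => rho xc.2) fst); first exact: frame_ctx1.
      by move=> i; have := vr i => ?; isvar_tac.
    by isvar_tac.
  by apply: def_time_add; [exact: frame_ctx1| | |]; isvar_tac.
- apply: (@def_eqv _ _ _ _ _ _ _ (fun D c => exists u u', 
    tri_time u = zpoly_eval p (times (rho c)) /\
    (tri_time u' = zpoly_eval q (times (rho c)) /\ time_add u u' (z c)))).
    move=> D c; split=> [[u [u' [<- [<- /time_addE]]]]|H] //.
    exists (pttri (mkpt 0 0 (zpoly_eval p (times (rho c))))),
      (pttri (mkpt 0 0 (zpoly_eval q (times (rho c))))).
    by rewrite time_addE !time_pttri.
  have fv2 := frame_ctx1 (frame_ctx1 fv).
  have vr2 i : isvar (ctx1 (ctx1 e)) (fun xc => tnth (rho xc.2.2) i).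
    by have := vr i => ?; isvar_tac.
  apply: def_ex; apply: def_ex; apply: def_and; last apply: def_and.
  + by apply: (IHp _ _ _ (fun xc => rho xc.2.2) (fun xc => xc.2.1)) => //; isvar_tac.
  + by apply: (IHq _ _ _ (fun xc => rho xc.2.2) fst) => //; isvar_tac.
  + by apply: def_time_add => //; isvar_tac.
- apply: (@def_eqv _ _ _ _ _ _ _ (fun D c => exists u u', 
    tri_time u = zpoly_eval p (times (rho c)) /\
    (tri_time u' = zpoly_eval q (times (rho c)) /\ time_mul u u' (z c)))).
    move=> D c; split=> [[u [u' [<- [<- /time_mulE]]]]|H] //.
    exists (pttri (mkpt 0 0 (zpoly_eval p (times (rho c))))),
      (pttri (mkpt 0 0 (zpoly_eval q (times (rho c))))).
    by rewrite time_mulE !time_pttri.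
  have fv2 := frame_ctx1 (frame_ctx1 fv).
  have vr2 i : isvar (ctx1 (ctx1 e)) (fun xc => tnth (rho xc.2.2) i).
    by have := vr i => ?; isvar_tac.
  apply: def_ex; apply: def_ex; apply: def_and; last apply: def_and.
  + by apply: (IHp _ _ _ (fun xc => rho xc.2.2) (fun xc => xc.2.1)) => //; isvar_tac.
  + by apply: (IHq _ _ _ (fun xc => rho xc.2.2) fst) => //; isvar_tac.
  + by apply: def_time_mul => //; isvar_tac.
Qed.

Lemma def_sum3 C N (e : C -> N.-tuple (triangle R)) (a : 'I_3 -> C -> triangle R) x :
  frame_vars e -> (forall j, isvar e (a j)) -> isvar e x ->
  tdef e (fun _ c => \sum_(j < 3) tri_time (a j c) = tri_time (x c) *+ 3).
Proof.
move=> fv va vx; pose rho c := [tuple a ord0 c; a (lift ord0 ord0) c;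
  a (lift ord0 (lift ord0 ord0)) c; x c].
pose v i : zpoly 4 := ZVar (inord i).
have vr i : isvar e (fun c => tnth (rho c) i).
  by case: i => -[|[|[|[|//]]]] lt; [apply: isvar_eq (va ord0)|
    apply: isvar_eq (va (lift ord0 ord0))|
    apply: isvar_eq (va (lift ord0 (lift ord0 ord0)))|apply: isvar_eq vx].
have [v0 _ _ _] := fv.
(* Since [fo] has time 0, taking it as the value makes the difference of the two sides vanish. *)
apply: (def_eqv _ (def_zpoly (ZAdd (ZAdd (v 0) (ZAdd (v 1) (v 2)))
  (ZOpp (ZAdd (v 3) (ZAdd (v 3) (v 3))))) fv vr v0)) => D c.
rewrite coord_fo /= !tnth_map !(tnth_nth (x c)) !inordK //=.
rewrite !big_ord_recl big_ord0 addr0 /=; split=> [/esym/subr0_eq -> | ->].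
  by rewrite !mulrS mulr0n addr0.
by rewrite !mulrS mulr0n addr0 subrr.
Qed.

Lemma def_is_corners C N (e : C -> N.-tuple (triangle R)) t (a : nat -> C -> triangle R) :
  frame_vars e -> isvar e t -> (forall i, (i < 9)%N -> isvar e (a i)) ->
  tdef e (fun _ c => is_corners (t c) (fun i => tri_time (a i c))).
Proof.
move=> fv vt va; apply: (@def_eqv _ _ _ _ _ _ _ (fun D c => corners_at (t c) (a^~ c))).
  by move=> D c; rewrite corners_atE.
have va3 (j : 'I_3) : [/\ isvar e (a (3 * j)%N), isvar e (a (3 * j).+1)
    & isvar e (a (3 * j).+2)].
  by have := ltn_ord j; split; apply: va; lia.
have fvs := @frame_ctxs 3 _ _ _ fv.
apply: def_exs; apply: def_and; last (apply: def_and; last apply: def_and).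
- apply: tdef_forall => j; have [? ? ?] := va3 j.
  apply: def_and; first by apply: def_is_point; isvar_tac.
  by apply: def_center_at => //; isvar_tac.
- by apply: tdef_forall => j; apply: def_part; isvar_tac.
- apply: def_all; apply: def_imp; last by apply: def_part; isvar_tac.
  by apply: tdef_forall => j; apply: def_part; isvar_tac.
- have fv4 := frame_ctx1 (frame_ctx1 (frame_ctx1 fvs)).
  do 3 apply: def_ex; apply: def_and; first by apply: def_center_at => //; isvar_tac.
  apply: def_and.
    apply: (def_sum3 (a := fun j xc => a (3 * j)%N xc.2.2.2.2)) => //.
      by move=> j; have [? ? ?] := va3 j; isvar_tac.
    by isvar_tac.
  apply: (def_sum3 (a := fun j xc => a (3 * j).+1 xc.2.2.2.2)) => //.
    by move=> j; have [? ? ?] := va3 j; isvar_tac.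
  by isvar_tac.
Qed.

Definition is_corners_tuple k (T : k.-tuple (triangle R)) (v : (9 * k).-tuple R) :=
  forall j, is_corners (tnth T j) (fun i => nth 0 v (9 * j + i)).

Lemma def_is_corners_tuple C N (e : C -> N.-tuple (triangle R)) k
    (T : C -> k.-tuple (triangle R)) (a : C -> (9 * k).-tuple (triangle R)) :
  frame_vars e -> (forall j, isvar e (fun c => tnth (T c) j)) ->
  (forall j, isvar e (fun c => tnth (a c) j)) ->
  tdef e (fun _ c => is_corners_tuple (T c) (times (a c))).
Proof.
move=> fv vT va; apply: tdef_forall => j.
have lt i : (i < 9)%N -> (9 * j + i < 9 * k)%N by have := ltn_ord j; lia.
apply: (@def_eqv _ _ _ _ _ _ _ (fun D c => is_corners (tnth (T c) j)
    (fun i => tri_time (nth (fo R) (a c) (9 * j + i))))).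
  move=> D c; split=> -[s Hs]; exists s => i i9; rewrite Hs //;
    by rewrite (nth_map (fo R)) ?size_tuple ?lt.
apply: (def_is_corners (a := fun i c => nth (fo R) (a c) (9 * j + i))) => // i i9.
apply: isvar_eq (va (Ordinal (lt i i9))) => c.
by rewrite (tnth_nth (fo R)).
Qed.

Lemma is_corners_coords k (T : k.-tuple (triangle R)) v : is_corners_tuple T v <->
  exists s : 'I_k -> 'S_3, coords [tuple permute_corners (tnth T i) (s i) | i < k] = v.
Proof.
split=> [/boolp.choice[s Hs]|[s <-] j].
  exists s; apply: eq_coords => j i i9.
  by rewrite nth_coords // tnth_mktuple Hs.
by exists (s j) => i i9; rewrite nth_coords // tnth_mktuple.
Qed.

(** The corners of T are known only up to order; closure of the relation under permutations makes
    this harmless. *)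
Lemma coords_set_corners (D : pstruct R sigma) (r : relname sigma) v :
  (@coords R _ @` @ps_set _ _ D r) v <-> exists T, ps_set D T /\ is_corners_tuple T v.
Proof.
split=> [[T DT <-]|[T [DT /is_corners_coords[s <-]]]].
  exists T; split=> //; apply/is_corners_coords; exists (fun=> 1%g).
  congr coords; apply: eq_from_tnth => j; rewrite tnth_mktuple.
  by apply: triangle_inj => i; rewrite cor_perm perm1.
by apply/image_coordsE; apply: ps_perm.
Qed.

Lemma tnth_ctx1_cons C N (e : C -> N.-tuple (triangle R)) n
    (rho : C -> n.-tuple (triangle R)) :
  (forall i, isvar e (fun c => tnth (rho c) i)) ->
  forall i, isvar (ctx1 e) (fun xc => tnth (cons_tuple xc.1 (rho xc.2)) i).
Proof.
move=> vr i; case: (unliftP ord0 i) => [j|] ->.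
  by apply: isvar_eq (isvar_ctx1 (vr j)) => c; rewrite tnthS.
exact: isvar_eq (isvar_new e).
Qed.

Lemma times_cons n (t : triangle R) (v : n.-tuple (triangle R)) :
  times (cons_tuple t v) = cons_tuple (tri_time t) (times v).
Proof. exact: val_inj. Qed.

(** A real variable is read as the time of a triangle variable. As every real is the time of some
    triangle, real quantifiers become triangle quantifiers. *)
Lemma def_holds_real n (f : formula (real_atom sigma) n) C N
    (e : C -> N.-tuple (triangle R)) (rho : C -> n.-tuple (triangle R)) :
  frame_vars e -> (forall i, isvar e (fun c => tnth (rho c) i)) ->
  tdef e (fun D c => holds (@real_psat R sigma D) f (times (rho c))).
Proof.
elim: n / f C N e rho => [n [p|r w]|n f IH|n f IHf h IHh|n f IHf h IHh|n f IH|n f IH]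
  C N e rho fv vr.
- apply: (@def_eqv _ _ _ _ _ _ _ (fun D c => exists z,
    tri_time z = zpoly_eval p (times (rho c)) /\ ~ Before z (fo R))).
    move=> D c; rewrite /Before coord_fo /=; split=> [[z [<- /negP]]|H].
      by rewrite -ltNge.
    exists (pttri (mkpt 0 0 (zpoly_eval p (times (rho c))))).
    by rewrite time_pttri; split=> //=; apply/negP; rewrite -ltNge.
  have [v0 _ _ _] := fv; apply: def_ex; apply: def_and.
    apply: (def_zpoly p (rho := fun xc => rho xc.2) (z := fst)).
    + exact: frame_ctx1.
    + by move=> i; have := vr i => ?; isvar_tac.
    + by isvar_tac.
  by apply: def_not; apply: def_Before; isvar_tac.
- pose a c := map_tuple (tnth (rho c)) w.
  apply: (@def_eqv _ _ _ _ _ _ _ (fun D c => exists T, 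
    @ps_set _ _ D r T /\ is_corners_tuple T (times (a c)))).
    move=> D c; rewrite -coords_set_corners /=.
    suff -> : times (a c) = map_tuple (tnth (times (rho c))) w by [].
    by apply: eq_from_tnth => i; rewrite !tnth_map.
  apply: def_exs; apply: def_and.
    by apply: def_set => j; isvar_tac.
  apply: (def_is_corners_tuple (T := fst) (a := fun xc => a xc.2)).
  + exact: frame_ctxs.
  + by move=> j; isvar_tac.
  + move=> j; have : isvar e (fun c => tnth (a c) j).
      by apply: isvar_eq (vr (tnth w j)) => c; rewrite tnth_map.
    by move=> ?; isvar_tac.
- by apply: def_not; apply: IH.
- by apply: def_and; [apply: IHf|apply: IHh].
- by apply: def_or; [apply: IHf|apply: IHh].
- apply: (@def_eqv _ _ _ _ _ _ _ (fun D c => exists t,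
    holds (@real_psat R sigma D) f (times (cons_tuple t (rho c))))).
    move=> D c /=; rewrite ex_time; split=> -[t Ht]; exists t; move: Ht;
      by rewrite times_cons.
  apply: def_ex; apply: (IH _ _ _ (fun xc => cons_tuple xc.1 (rho xc.2))).
    exact: frame_ctx1.
  exact: tnth_ctx1_cons.
- apply: (@def_eqv _ _ _ _ _ _ _ (fun D c => forall t,
    holds (@real_psat R sigma D) f (times (cons_tuple t (rho c))))).
    move=> D c /=; split=> H x; last by rewrite times_cons.
    by have := H (pttri (mkpt 0 0 x)); rewrite times_cons time_pttri.
  apply: def_all; apply: (IH _ _ _ (fun xc => cons_tuple xc.1 (rho xc.2))).
    exact: frame_ctx1.
  exact: tnth_ctx1_cons.
Qed.

End TriangleDefinable.

(** * Quantifying the frame away *)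

Section Completeness.
Variables (R : realType) (sigma : schema) (k : nat).
Implicit Types (D : pstruct R sigma) (T : k.-tuple (triangle R)).

Notation tdef := (@definable (tri_atom sigma) (triangle R) (pstruct R sigma)
  (@tri_psat R sigma)).

Definition ctx4 := ctx1 (ctx1 (ctx1 (ctx1 (@id (k.-tuple (triangle R)))))).

(** Here the four frame variables carry fixed values and T alone is the context, so formulas are
    characterized in the standard frame only; other frames are reached by the group action. *)
Definition std_ctx (T : k.-tuple (triangle R)) := ctx4 (fy R, (fx R, (fw R, (fo R, T)))).

(** The formula asks for some frame in which h holds of the coordinates of T. The permutations s
    appear because the corners of T are recovered only up to order. *)
Lemma invariant_triangle_definable (h : formula (real_atom sigma) (9 * k)) :
  (forall g D T, valid g -> holds (@real_psat R sigma (pull g D)) h (coords T) <->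
     holds (@real_psat R sigma D) h (coords (acts g T))) ->
  exists f : formula (tri_atom sigma) k, forall D T,
    holds (@tri_psat R sigma D) f T <->
    exists s : 'I_k -> 'S_3, holds (@real_psat R sigma D) h
      (coords [tuple permute_corners (tnth T i) (s i) | i < k]).
Proof.
move=> hinv.
have [fr Hfr] : tdef ctx4 (fun _ c => frame c.2.2.2.1 c.2.2.1 c.2.1 c.1).
  by apply: def_frame; rewrite /ctx4; isvar_tac.
have [fk Hfk] : tdef std_ctx (fun D T => exists a : (9 * k).-tuple (triangle R),
    is_corners_tuple T (times a) /\ holds (@real_psat R sigma D) h (times a)).
  have fv : frame_vars std_ctx.
    by split; [exists (inord 3)|exists (inord 2)|exists (inord 1)|exists (inord 0)] => T;
      rewrite (tnth_nth (fo R)) /= inordK.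
  have vT j : isvar std_ctx (fun T => tnth T j).
    by exists (rshift 4 j) => T; rewrite !(tnth_nth (fo R)).
  apply: def_exs; apply: def_and.
    apply: (@def_is_corners_tuple R sigma _ _ _ k snd fst); first exact: frame_ctxs.
      by move=> j; have := vT j => ?; isvar_tac.
    by move=> j; isvar_tac.
  by apply: (@def_holds_real R sigma _ h _ _ _ fst) => [|j]; [apply: frame_ctxs|isvar_tac].
exists (Ex (Ex (Ex (Ex (And fr fk))))) => D T.
have stdE D' T' : holds (@tri_psat R sigma D') fk (std_ctx T') <->
  exists s : 'I_k -> 'S_3, holds (@real_psat R sigma D') h
      (coords [tuple permute_corners (tnth T' i) (s i) | i < k]).
  rewrite Hfk; split=> [[a [/is_corners_coords[s <-] H]]|[s H]]; first by exists s.
  exists [tuple pttri (mkpt 0 0 (tnth (coords [tuple permute_corners (tnth T' i) (s i) | i < k]) j)) | j < 9 * k].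
  rewrite (_ : times _ = coords [tuple permute_corners (tnth T' i) (s i) | i < k]).
    by split=> //; apply/is_corners_coords; exists s.
  by apply: eq_from_tnth => j; rewrite tnth_map tnth_mktuple time_pttri.
have ctxE g T' : acts g (std_ctx T') = ctx4 (act g (fy R), (act g (fx R), (act g (fw R), (act g (fo R), acts g T')))).
  exact: val_inj.
split=> [[o [w [x [y [/= Hr Hk]]]]]|H].
  (* The frame is g applied to the standard one, and T is g applied to g^-1 T. So the body holds in
     the standard frame for g^-1 D and g^-1 T, and invariance of h leads back to D and T. *)
  have /frame_act_std[g vg [eo ew ex ey]] : frame o w x y.
    by apply/(Hfr D (y, (x, (w, (o, T))))).
  have : holds (@tri_psat R sigma D) fk (acts g (std_ctx (acts (ginv g) T))).
    by rewrite ctxE -eo -ew -ex -ey actsVK.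
  move/(holds_pull _ _ _ vg)/stdE => [s Hs]; exists s.
  move/(hinv _ _ _ vg): Hs; congr (holds _ _ (coords _)).
  apply: eq_from_tnth => i; rewrite tnth_map !tnth_mktuple act_perm.
  by rewrite -[X in permute_corners X]tnth_map; congr (permute_corners (tnth _ _) _); exact: actsVK.
exists (fo R), (fw R), (fx R), (fy R); split.
  by apply/(Hfr D (fy R, (fx R, (fw R, (fo R, T))))); exact: frame_std.
exact/stdE.
Qed.

Lemma real_expressible_expressed (Q : database R sigma -> option (strelation R k)) :
  generic Q -> FO_real_expressible Q -> FO_triangle_expressed Q.
Proof.
move=> genQ [f Hf]; have [h Hh] := @open_holds_definable R sigma k f.
have [|F HF] := @invariant_triangle_definable h.
  by move=> g D T vg; rewrite !Hh; apply: open_holds_pull.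
exists F => D; have [S QD SE] := Hf D; exists S => //.
have openE T := open_holds_database genQ Hf T QD.
apply/seteqP; split=> T /=.
  move=> ST; apply/(HF (of_db D)); exists (fun=> 1%g); apply/Hh/openE.
  suff -> : [tuple permute_corners (tnth T i) 1%g | i < k] = T by [].
  apply: eq_from_tnth => j; rewrite tnth_mktuple.
  by apply: triangle_inj => i; rewrite cor_perm perm1.
(* The output S is itself closed under corner permutations, so s can be undone. *)
move=> /(HF (of_db D))[s /Hh/openE] /(@strel_perm _ _ S _ (fun i => (s i)^-1)%g).
congr (strel_set S _); apply: eq_from_tnth => j; rewrite !tnth_mktuple.
by apply: triangle_inj => i; rewrite !cor_perm permKV.
Qed.

End Completeness.

Theorem mainTheorem3 (R : realType) (sigma : schema) (k : nat) :
  (forall Q : query R sigma k,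
     FO_triangle_expressed Q -> generic Q /\ FO_real_expressible Q) /\
  (forall Q : query R sigma k,
     generic Q -> FO_real_expressible Q -> FO_triangle_expressed Q).
Proof.
split=> Q; last exact: real_expressible_expressed.
by move=> H; split; [apply: expressed_generic|apply: expressed_real_expressible].
Qed.
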